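(* There is an isomorphism of algebras $\psi:\mathbb{H}(G,\bar k_0)\to\mathbb{D}(G,k)$ given by $\psi(e_i)=D_i(G,k)$, $\psi(t_{\theta_i})=\xi_i$, $\psi(t_{(u,v)})=s_{u,v}^{[0]}$ for $1\le i\le n$ and $1\le u\ne v\le n$.
   Context: Let $r,n\ge 1$ be integers and $\xi\in\mathbb{C}$ a primitive $r$-th root of unity. Symplectic reflection algebra. Let $V$ be a hermitian space with orthonormal basis $v_1,\dots,v_n$ and dual basis $\alpha_1,\dots,\alpha_n$ of $V^*$; $\langle\cdot,\cdot\rangle$ is the pairing of $V$ and $V^*$. $G\subset U(V)$ is the complex reflection group of type $G(r,1,n)$ whose reflections are: $\xi_i^t$ ($1\le i\le n$, $1\le t\le r-1$), where $\xi_i(v_i)=\xi v_i$ and $\xi_i(v_j)=v_j$ for $j\ne i$; and $s_{i,j}^{[m]}$ ($i\ne j$, $0\le m\le r-1$), the reflection of order 2 exchanging $v_j$ and $\xi^m v_i$ and fixing $v_l$ for $l\neq i,j$. Let $k$ be a $G$-invariant complex function on the set of reflections, with value $k_t$ on every $\xi_i^t$ and value $\bar k_0$ on every $s_{i,j}^{[m]}$. For $i\ne j$ and $0\le m\le r-1$ put $\alpha_{i,j}^{[m]}=\xi^{-m}\alpha_i-\alpha_j$ and $v_{i,j}^{[m]}=\frac12(\xi^{m}v_i-v_j)$. The algebra $\mathcal{H}(G,k)$ is the $\mathbb{C}$-algebra generated by $x\in V^*$, $y\in V$ and $g\in G$ (linearly in $x$ and $y$, with the group relations of $G$), with relations $gxg^{-1}=g(x)$,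 $gyg^{-1}=g(y)$, $[x_1,x_2]=0$, $[y_1,y_2]=0$ and $$[y,x]=\langle y,x\rangle-\sum_{t=1}^{r-1}k_t\sum_{i=1}^n\langle y,\alpha_i\rangle\langle v_i,x\rangle\xi_i^t-\bar k_0\sum_{m=0}^{r-1}\sum_{1\le i\ne j\le n}\langle y,\alpha_{i,j}^{[m]}\rangle\langle v_{i,j}^{[m]},x\rangle s_{i,j}^{[m]}.$$ $\mathbb{D}(G,k)$ is the subalgebra of $\mathcal{H}(G,k)$ generated by $G$ and the elements $v_i\alpha_i$ ($1\le i\le n$). For $1\le j\le n$, $$D_j(G,k)=v_j\alpha_j+\sum_{1\le i<j}\tilde k_{(i,j)}s_{i,j}^{[0]},\qquad \tilde k_{(i,j)}=\frac{\bar k_0}{2}\sum_{m=0}^{r-1}(\xi_i^m\xi_j^{-m}+\xi_j^m\xi_i^{-m}).$$ Generalized graded Hecke algebra. Let $V_0$ be a hermitian space with orthonormal basis $e_1,\dots,e_n$, on which $G$ is realized as the group generated by the transpositions $(u,v)$ (exchanging $e_u$ and $e_v$ and fixing the other $e_l$) and the $\theta_i$ ($\theta_i(e_i)=\xi e_i$, $\theta_i(e_j)=e_j$ for $j\ne i$). For $c_0\in\mathbb{C}$ and $u\ne v$ put $\tilde c_{u,v}=\frac{c_0}{2}\sum_{m=0}^{r-1}(\theta_u^m\theta_v^{-m}+\theta_u^{-m}\theta_v^{m})$. The algebra $\mathbb{H}(G,c_0)$ is the $\mathbb{C}$-algebra generated by $e_1,\dots,e_n$ and $t_g$ ($g\in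 G$) with relations: $[e_i,e_j]=0$; $t_gt_h=t_{gh}$ ($t_1=1$); $t_{\theta_i}e_j=e_jt_{\theta_i}$ for all $i,j$; $t_{(j,j+1)}e_i=e_it_{(j,j+1)}$ for $i\ne j,j+1$; $t_{(i,i+1)}e_i=e_{i+1}t_{(i,i+1)}-\tilde c_{i,i+1}$ for $1\le i\le n-1$ (with $\tilde c_{i,i+1}$ viewed in the algebra via $g\mapsto t_g$). *)

(* Defs.v *)
From HB Require Import structures.
From mathcomp Require Import all_boot all_order all_fingroup all_algebra.
From mathcomp Require Import generic_quotient ring_quotient.
From mathcomp Require Import boolp reals complex.
From mathcomp.multinomials Require Import monalg.

Set Implicit Arguments.
Unset Strict Implicit.
Unset Printing Implicit Defensive.

Import Order.TTheory GRing.Theory Num.Theory.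
Local Open Scope quotient_scope.
Local Open Scope ring_scope.

Section FreeAlgebra.
Variables (K : comNzRingType) (X : choiceType).

(* The free associative algebra on X is the monoid algebra of the free monoid
   on X. *)
Definition free_alg : Type := {malg K[{fmonom X}]}.

HB.instance Definition _ := GRing.Lalgebra.on free_alg.

Lemma free_alg_scalerAr (a : K) (x y : free_alg) : a *: (x * y) = x * (a *: y).
Proof.
apply/malgP => m; rewrite mcoeffZ (mcoeffMl x y).
rewrite (mcoeffMlw (d1 := msupp x) (d2 := msupp y)) //; last exact: msuppZ_le.
rewrite mulr_sumr; apply: eq_bigr => i _.
rewrite mulr_sumr; apply: eq_bigr => j _.
by rewrite mcoeffZ mulrnAr mulrCA.
Qed.

HB.instance Definition _ :=
  GRing.Lalgebra_isAlgebra.Build K free_alg free_alg_scalerAr.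

Definition free_gen (x : X) : free_alg := << fmu x >>.

End FreeAlgebra.

Section PresentedAlgebra.
Variables (K : comNzRingType) (X : choiceType).
Variable rel : free_alg K X -> free_alg K X -> Prop.

(* The two-sided ideal generated by the a - b such that rel a b. *)
Inductive in_rel_ideal : free_alg K X -> Prop :=
| in_rel_ideal_rel a b of rel a b : in_rel_ideal (a - b)
| in_rel_ideal0 : in_rel_ideal 0
| in_rel_idealD a b of in_rel_ideal a & in_rel_ideal b : in_rel_ideal (a + b)
| in_rel_idealMl c a of in_rel_ideal a : in_rel_ideal (c * a)
| in_rel_idealMr c a of in_rel_ideal a : in_rel_ideal (a * c).

Definition rel_ideal : {pred free_alg K X} := fun a => `[< in_rel_ideal a >].

Lemma rel_idealP a : reflect (in_rel_ideal a) (a \in rel_ideal).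
Proof. exact: asboolP. Qed.

Lemma rel_ideal_zmod_closed : zmod_closed rel_ideal.
Proof.
split=> [|a b /rel_idealP Ia /rel_idealP Ib]; apply/rel_idealP.
  exact: in_rel_ideal0.
by apply: in_rel_idealD => //; rewrite -mulN1r; apply: in_rel_idealMl.
Qed.

HB.instance Definition _ :=
  GRing.isZmodClosed.Build (free_alg K X) rel_ideal rel_ideal_zmod_closed.

Lemma rel_idealMl c a : a \in rel_ideal -> c * a \in rel_ideal.
Proof. by move=> /rel_idealP Ia; apply/rel_idealP/in_rel_idealMl. Qed.

Lemma rel_idealMr c a : a \in rel_ideal -> a * c \in rel_ideal.
Proof. by move=> /rel_idealP Ia; apply/rel_idealP/in_rel_idealMr. Qed.

Lemma rel_idealZ (c : K) a : a \in rel_ideal -> c *: a \in rel_ideal.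
Proof. by move=> Ia; rewrite -[a]mul1r scalerAl rel_idealMl. Qed.

(* The K-algebra with generators X and relations a = b for rel a b.  It might
   a priori be the zero ring, so it carries a pzRingType and an lmodType
   structure, rather than an algType one (which requires 1 != 0); the two
   compatibility laws of an algebra are pres_scalerAl and pres_scalerAr. *)
Definition pres_alg : Type := {ideal_quot rel_ideal}.

HB.instance Definition _ := GRing.Zmodule.on pres_alg.
HB.instance Definition _ := EqQuotient.on pres_alg.

Definition pres_pi (a : free_alg K X) : pres_alg := \pi_pres_alg a.

Let piP a b : (pres_pi a = pres_pi b) <-> (a - b \in rel_ideal).
Proof. by rewrite (Quotient.idealrBE rel_ideal); split=> /eqP. Qed.

Definition pres_one : pres_alg := pres_pi 1.
Definition pres_mul (a b : pres_alg) : pres_alg := pres_pi (repr a * repr b).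
Definition pres_scale (c : K) (a : pres_alg) : pres_alg := pres_pi (c *: repr a).

Let piK (a : pres_alg) : pres_pi (repr a) = a.
Proof. exact: reprK. Qed.

Let pi_mul a b : pres_mul (pres_pi a) (pres_pi b) = pres_pi (a * b).
Proof.
have /piP := piK (pres_pi b); have /piP := piK (pres_pi a).
rewrite /pres_mul; move: (repr (pres_pi a)) (repr (pres_pi b)) => a' b' Ia Ib; apply/piP.
have -> : a' * b' - a * b = (a' - a) * b' + a * (b' - b).
  by rewrite mulrBl mulrBr addrA subrK.
by apply: rpredD; [apply: rel_idealMr | apply: rel_idealMl].
Qed.

Let pi_scale c a : pres_scale c (pres_pi a) = pres_pi (c *: a).
Proof.
have /piP := piK (pres_pi a); rewrite /pres_scale; move: (repr _) => a' Ia.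
by apply/piP; rewrite -scalerBr; apply: rel_idealZ.
Qed.

Let pi_add a b : pres_pi a + pres_pi b = pres_pi (a + b).
Proof. by rewrite /pres_pi raddfD. Qed.

Let pres_ind (P : pres_alg -> Prop) : (forall a, P (pres_pi a)) -> forall a, P a.
Proof. by move=> h a; rewrite -[a]piK. Qed.

Fact pres_mulA : associative pres_mul.
Proof.
by elim/pres_ind=> a; elim/pres_ind=> b; elim/pres_ind=> c; rewrite !pi_mul mulrA.
Qed.

Fact pres_mul1l : left_id pres_one pres_mul.
Proof. by elim/pres_ind=> a; rewrite pi_mul mul1r. Qed.

Fact pres_mul1r : right_id pres_one pres_mul.
Proof. by elim/pres_ind=> a; rewrite pi_mul mulr1. Qed.

Fact pres_mulDl : left_distributive pres_mul +%R.
Proof.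
elim/pres_ind=> a; elim/pres_ind=> b; elim/pres_ind=> c.
by rewrite pi_add !pi_mul mulrDl -pi_add.
Qed.

Fact pres_mulDr : right_distributive pres_mul +%R.
Proof.
elim/pres_ind=> a; elim/pres_ind=> b; elim/pres_ind=> c.
by rewrite pi_add !pi_mul mulrDr -pi_add.
Qed.

HB.instance Definition _ := GRing.Zmodule_isPzRing.Build pres_alg
  pres_mulA pres_mul1l pres_mul1r pres_mulDl pres_mulDr.

Fact pres_scaleA c d a : pres_scale c (pres_scale d a) = pres_scale (c * d) a.
Proof. by elim/pres_ind: a => a; rewrite !pi_scale scalerA. Qed.

Fact pres_scale1 : left_id 1 pres_scale.
Proof. by elim/pres_ind=> a; rewrite pi_scale scale1r. Qed.

Fact pres_scaleDr : right_distributive pres_scale +%R.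
Proof.
move=> c; elim/pres_ind=> a; elim/pres_ind=> b.
by rewrite pi_add !pi_scale scalerDr -pi_add.
Qed.

Fact pres_scaleDl a : {morph pres_scale^~ a : c d / c + d}.
Proof. by elim/pres_ind: a => a c d; rewrite !pi_scale scalerDl -pi_add. Qed.

HB.instance Definition _ := GRing.Zmodule_isLmodule.Build K pres_alg
  pres_scaleA pres_scale1 pres_scaleDr pres_scaleDl.

Lemma pres_scalerAl (c : K) (a b : pres_alg) : c *: (a * b) = (c *: a) * b.
Proof.
elim/pres_ind: a => a; elim/pres_ind: b => b.
rewrite /GRing.mul /GRing.scale /=.
by rewrite pi_scale !pi_mul pi_scale scalerAl.
Qed.

Lemma pres_scalerAr (c : K) (a b : pres_alg) : c *: (a * b) = a * (c *: b).
Proof.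
elim/pres_ind: a => a; elim/pres_ind: b => b.
rewrite /GRing.mul /GRing.scale /=.
by rewrite pi_scale !pi_mul pi_scale scalerAr.
Qed.

Fact pres_pi_zmod_morphism : zmod_morphism pres_pi.
Proof. exact: raddfB. Qed.

HB.instance Definition _ :=
  GRing.isZmodMorphism.Build (free_alg K X) pres_alg pres_pi
    pres_pi_zmod_morphism.

Fact pres_pi_monoid_morphism : monoid_morphism pres_pi.
Proof. by split=> // a b; rewrite -pi_mul. Qed.

HB.instance Definition _ :=
  GRing.isMonoidMorphism.Build (free_alg K X) pres_alg pres_pi
    pres_pi_monoid_morphism.

Fact pres_pi_scalable : scalable pres_pi.
Proof. by move=> c a; rewrite -pi_scale. Qed.

HB.instance Definition _ :=
  GRing.isScalable.Build K (free_alg K X) pres_alg *:%R pres_pi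
    pres_pi_scalable.

Lemma pres_pi_rel a b : rel a b -> pres_pi a = pres_pi b.
Proof. by move=> ab; apply/piP/rel_idealP/in_rel_ideal_rel. Qed.

Lemma pres_piP a b : pres_pi a = pres_pi b <-> in_rel_ideal (a - b).
Proof. by rewrite piP; split=> /rel_idealP. Qed.

Lemma pres_pi_surj (a : pres_alg) : exists b, a = pres_pi b.
Proof. by exists (repr a); rewrite piK. Qed.

End PresentedAlgebra.

Section Subalgebra.
Variables (K : comNzRingType) (X : choiceType).
Variable rel : free_alg K X -> free_alg K X -> Prop.
Local Notation A := (pres_alg rel).
Variable S : A -> Prop.

Inductive in_subalg : A -> Prop :=
| in_subalg_gen a of S a : in_subalg a
| in_subalg1 : in_subalg 1
| in_subalgD a b of in_subalg a & in_subalg b : in_subalg (a + b)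
| in_subalgM a b of in_subalg a & in_subalg b : in_subalg (a * b)
| in_subalgZ (c : K) a of in_subalg a : in_subalg (c *: a).

Definition subalg_pred : {pred A} := fun a => `[< in_subalg a >].

Lemma subalg_predP a : reflect (in_subalg a) (a \in subalg_pred).
Proof. exact: asboolP. Qed.

Lemma subalg_pred_subring_closed : subring_closed subalg_pred.
Proof.
split=> [|a b /subalg_predP Sa /subalg_predP Sb|a b /subalg_predP Sa /subalg_predP Sb];
  apply/subalg_predP.
- exact: in_subalg1.
- by apply: in_subalgD => //; rewrite -scaleN1r; apply: in_subalgZ.
- exact: in_subalgM.
Qed.

Lemma subalg_pred_scaler_closed : scaler_closed subalg_pred.
Proof. by move=> c a /subalg_predP Sa; apply/subalg_predP/in_subalgZ. Qed.

HB.instance Definition _ :=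
  GRing.isSubringClosed.Build A subalg_pred subalg_pred_subring_closed.
HB.instance Definition _ :=
  GRing.isScaleClosed.Build K A subalg_pred subalg_pred_scaler_closed.

(* The subalgebra generated by S, as a type. *)
Record subalg : Type := Subalg {
  subalg_val :> A;
  subalg_valP : subalg_val \in subalg_pred
}.

HB.instance Definition _ := [isSub for subalg_val].
HB.instance Definition _ := [Choice of subalg by <:].
HB.instance Definition _ :=
  GRing.SubChoice_isSubPzRing.Build A subalg_pred subalg
    subalg_pred_subring_closed.
HB.instance Definition _ := [SubZmodule_isSubLmodule of subalg by <:].

End Subalgebra.

Section ReflectionGroups.
Variables (R : realType) (r n : nat) (xi : R[i]).
Local Notation C := R[i].

(* The vectors of an n-dimensional hermitian space with a fixed orthonormal
   basis are the columns of coordinates, linear forms are rows, and linear maps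
   are n x n matrices acting on columns on the left. *)
Definition basis_vec (i : 'I_n) : 'cV[C]_n := delta_mx i 0.
Definition dual_vec (i : 'I_n) : 'rV[C]_n := delta_mx 0 i.
Definition pairing (y : 'cV[C]_n) (x : 'rV[C]_n) : C := (x *m y) 0 0.

(* The matrix of the linear map sending the l-th basis vector to f l. *)
Definition mx_of_images (f : 'I_n -> 'cV[C]_n) : 'M[C]_n :=
  \matrix_(a, l) f l a 0.

Section GeneratedGroup.
Variable S : 'M[C]_n -> Prop.

Inductive in_gengroup : 'M[C]_n -> Prop :=
| in_gengroup_gen g of S g : in_gengroup g
| in_gengroup1 : in_gengroup 1%:M
| in_gengroupM g h of in_gengroup g & in_gengroup h : in_gengroup (g *m h)
| in_gengroupV g of in_gengroup g : in_gengroup (invmx g).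

Definition gengroup_pred : pred 'M[C]_n := fun g => `[< in_gengroup g >].

Record gengroup : Type := GenGroup {
  gengroup_val :> 'M[C]_n;
  gengroup_valP : gengroup_pred gengroup_val
}.

HB.instance Definition _ := [isSub for gengroup_val].
HB.instance Definition _ := [Choice of gengroup by <:].

Definition mk_gengroup g (Sg : in_gengroup g) : gengroup :=
  GenGroup (introT (asboolP _) Sg).

Lemma gengroupP (g : gengroup) : in_gengroup g.
Proof. exact/asboolP/gengroup_valP. Qed.

Definition gengroup_one : gengroup := mk_gengroup in_gengroup1.
Definition gengroup_mul (g h : gengroup) : gengroup :=
  mk_gengroup (in_gengroupM (gengroupP g) (gengroupP h)).
Definition gengroup_inv (g : gengroup) : gengroup :=
  mk_gengroup (in_gengroupV (gengroupP g)).

Fact gengroup_mulA : associative gengroup_mul.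
Proof. by move=> f g h; apply/val_inj; rewrite /= mulmxA. Qed.
Fact gengroup_mul1 : left_id gengroup_one gengroup_mul.
Proof. by move=> g; apply/val_inj; rewrite /= mul1mx. Qed.
Fact gengroup_mulr1 : right_id gengroup_one gengroup_mul.
Proof. by move=> g; apply/val_inj; rewrite /= mulmx1. Qed.

(* The group operations.  The laws of a group hold as soon as the elements of S
   are invertible, which is not part of the type: for the two groups below it
   follows from xi being a root of unity. *)
HB.instance Definition _ := isMonoid.Build gengroup
  gengroup_mulA gengroup_mul1 gengroup_mulr1.
HB.instance Definition _ := hasInv.Build gengroup gengroup_inv.

End GeneratedGroup.

Definition xi_mx (i : 'I_n) : 'M[C]_n :=
  mx_of_images (fun l => if l == i then xi *: basis_vec i else basis_vec l).

(* For i != j: exchanges v_j and xi^m v_i, and fixes the other v_l.  When xi^r = 1, it only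
   depends on m modulo r. *)
Definition s_mx (i j : 'I_n) (m : nat) : 'M[C]_n :=
  mx_of_images (fun l => if l == j then xi ^+ m *: basis_vec i
                    else if l == i then xi ^- m *: basis_vec j
                    else basis_vec l).

(* The reflections xi_i^t are powers of xi_i, so that G is generated by the
   xi_i and the s_(i,j)^[m]; for r = 1, xi_i is the identity. *)
Inductive G_gen : 'M[C]_n -> Prop :=
| G_gen_xi i : G_gen (xi_mx i)
| G_gen_s i j m of i != j : G_gen (s_mx i j m).

Definition G := gengroup G_gen.

Lemma xi_mx_in (i : 'I_n) : in_gengroup G_gen (xi_mx i).
Proof. exact/in_gengroup_gen/G_gen_xi. Qed.

Definition xi_ (i : 'I_n) : G := mk_gengroup (xi_mx_in i).

Lemma mx_of_images_basis f l : mx_of_images f *m basis_vec l = f l.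
Proof. by rewrite -colE; apply/matrixP => a b; rewrite ord1 !mxE. Qed.

Lemma mulmx_images A f :
  A *m mx_of_images f = mx_of_images (fun l => A *m f l).
Proof. by apply/matrixP => a l; rewrite !mxE; apply: eq_bigr => b _; rewrite mxE. Qed.

Lemma mx_of_images1 f : f =1 basis_vec -> mx_of_images f = 1%:M.
Proof. by move=> fE; apply/matrixP => a l; rewrite !mxE fE !mxE andbT. Qed.

Lemma s_mx_in (i j : 'I_n) (m : nat) : in_gengroup G_gen (s_mx i j m).
Proof.
have [<-|ij] := eqVneq i j; last exact/in_gengroup_gen/G_gen_s.
elim: m => [|m IHm].
  rewrite [s_mx _ _ _]mx_of_images1; first exact: in_gengroup1.
  by move=> l; case: eqP => [->|//]; rewrite expr0 scale1r.
have -> : s_mx i i m.+1 = xi_mx i *m s_mx i i m.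
  rewrite mulmx_images; congr mx_of_images; apply/funext => l.
  case: (l =P i) => [_|/eqP/negPf li]; last by rewrite mx_of_images_basis li.
  by rewrite -scalemxAr mx_of_images_basis eqxx scalerA exprSr.
exact: in_gengroupM (xi_mx_in i) IHm.
Qed.

Definition s_ (i j : 'I_n) (m : nat) : G := mk_gengroup (s_mx_in i j m).

Definition is_reflection (g : G) : Prop :=
  (exists i t, (1 <= t < r)%N /\ g = (xi_ i ^+ t)%g) \/
  (exists i j m, [/\ i != j, (m < r)%N & g = s_ i j m]).

(* The G-invariant functions on the set of reflections, with their values k_t
   on the xi_i^t and k_0 on the s_(i,j)^[m].  The values of mult_fun outside of
   the set of reflections are irrelevant. *)
Record multiplicity := Multiplicity {
  mult_fun :> G -> C;
  mult_t : nat -> C;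
  mult_0 : C;
  mult_invariant : forall g s, is_reflection s ->
    mult_fun (g * s * g^-1)%g = mult_fun s;
  mult_xi : forall i t, (1 <= t < r)%N -> mult_fun (xi_ i ^+ t)%g = mult_t t;
  mult_s : forall i j m, i != j -> (m < r)%N -> mult_fun (s_ i j m) = mult_0
}.

(* The group realized on V_0, where the basis is e_1, ..., e_n. *)
Definition theta_mx (i : 'I_n) : 'M[C]_n :=
  mx_of_images (fun l => if l == i then xi *: basis_vec i else basis_vec l).

Definition transp_mx (u v : 'I_n) : 'M[C]_n :=
  mx_of_images (fun l => basis_vec (tperm u v l)).

Inductive G0_gen : 'M[C]_n -> Prop :=
| G0_gen_transp u v of u != v : G0_gen (transp_mx u v)
| G0_gen_theta i : G0_gen (theta_mx i).

Definition G0 := gengroup G0_gen.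

Lemma theta_mx_in (i : 'I_n) : in_gengroup G0_gen (theta_mx i).
Proof. exact/in_gengroup_gen/G0_gen_theta. Qed.

Definition theta_ (i : 'I_n) : G0 := mk_gengroup (theta_mx_in i).

Lemma transp_mx_in (u v : 'I_n) : in_gengroup G0_gen (transp_mx u v).
Proof.
have [<-|uv] := eqVneq u v; last exact/in_gengroup_gen/G0_gen_transp.
rewrite [transp_mx _ _]mx_of_images1; first exact: in_gengroup1.
by move=> l; rewrite tperm1 perm1.
Qed.

Definition transp_ (u v : 'I_n) : G0 := mk_gengroup (transp_mx_in u v).

End ReflectionGroups.

Section SymplecticReflectionAlgebra.
Variables (R : realType) (r n : nat) (xi : R[i]).
Local Notation C := R[i].
Local Notation G := (G n xi).
Local Notation xi_ := (xi_ xi).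
Local Notation s_ := (s_ xi).
Local Notation v_ i := (basis_vec R i).
Local Notation alpha_ i := (dual_vec R i).
Variable k : multiplicity r n xi.

(* g acts on a linear form x by g(x) = x o g^-1. *)
Definition act_vec (g : G) (y : 'cV[C]_n) : 'cV[C]_n := g *m y.
Definition act_form (g : G) (x : 'rV[C]_n) : 'rV[C]_n := x *m invmx g.

Definition alpha_s (i j : 'I_n) (m : nat) : 'rV[C]_n :=
  xi ^- m *: alpha_ i - alpha_ j.
Definition v_s (i j : 'I_n) (m : nat) : 'cV[C]_n :=
  2^-1 *: (xi ^+ m *: v_ i - v_ j).

Definition H_index : choiceType := ('rV[C]_n + 'cV[C]_n + G)%type.
Local Notation F := (free_alg C H_index).
Definition H_free_x (x : 'rV[C]_n) : F := free_gen C (inl (inl x) : H_index).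
Definition H_free_y (y : 'cV[C]_n) : F := free_gen C (inl (inr y) : H_index).
Definition H_free_g (g : G) : F := free_gen C (inr g : H_index).
Local Notation X := H_free_x.
Local Notation Y := H_free_y.
Local Notation T := H_free_g.

Inductive H_rel : F -> F -> Prop :=
| H_rel_x_linear (a : C) x1 x2 : H_rel (X (a *: x1 + x2)) (a *: X x1 + X x2)
| H_rel_y_linear (a : C) y1 y2 : H_rel (Y (a *: y1 + y2)) (a *: Y y1 + Y y2)
| H_rel_g1 : H_rel (T 1%g) 1
| H_rel_gM g h : H_rel (T (g * h)%g) (T g * T h)
| H_rel_gx g x : H_rel (T g * X x * T g^-1%g) (X (act_form g x))
| H_rel_gy g y : H_rel (T g * Y y * T g^-1%g) (Y (act_vec g y))
| H_rel_xx x1 x2 : H_rel (X x1 * X x2 - X x2 * X x1) 0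
| H_rel_yy y1 y2 : H_rel (Y y1 * Y y2 - Y y2 * Y y1) 0
| H_rel_yx y x :
  H_rel (Y y * X x - X x * Y y)
    ((pairing y x)%:A
     - \sum_(1 <= t < r) mult_t k t *:
         (\sum_(i < n) (pairing y (alpha_ i) * pairing (v_ i) x)
            *: T (xi_ i ^+ t)%g)
     - mult_0 k *:
         (\sum_(m < r) \sum_(i < n) \sum_(j < n | i != j)
            (pairing y (alpha_s i j m) * pairing (v_s i j m) x)
              *: T (s_ i j m))).

Definition H_alg := pres_alg H_rel.
Definition H_x (x : 'rV[C]_n) : H_alg := pres_pi H_rel (X x).
Definition H_y (y : 'cV[C]_n) : H_alg := pres_pi H_rel (Y y).
Definition H_g (g : G) : H_alg := pres_pi H_rel (T g).

Inductive D_gen : H_alg -> Prop :=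
| D_gen_g g : D_gen (H_g g)
| D_gen_yx i : D_gen (H_y (v_ i) * H_x (alpha_ i)).

Definition D_alg := subalg D_gen.

Definition k_tilde (i j : 'I_n) : H_alg :=
  (mult_0 k / 2) *: \sum_(m < r)
     (H_g (xi_ i ^+ m * xi_ j ^- m)%g + H_g (xi_ j ^+ m * xi_ i ^- m)%g).

Definition D_ (j : 'I_n) : H_alg :=
  H_y (v_ j) * H_x (alpha_ j)
    + \sum_(i < n | (i < j)%N) k_tilde i j * H_g (s_ i j 0).

End SymplecticReflectionAlgebra.

Section GradedHeckeAlgebra.
Variables (R : realType) (r n : nat) (xi c0 : R[i]).
Local Notation C := R[i].
Local Notation G0 := (G0 n xi).
Local Notation theta_ := (theta_ xi).
Local Notation transp_ := (transp_ xi).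

Definition HH_index : choiceType := ('I_n + G0)%type.
Local Notation F := (free_alg C HH_index).
Definition HH_free_e (i : 'I_n) : F := free_gen C (inl i : HH_index).
Definition HH_free_t (g : G0) : F := free_gen C (inr g : HH_index).
Local Notation E := HH_free_e.
Local Notation T := HH_free_t.

Definition c_tilde (u v : 'I_n) : F :=
  (c0 / 2) *: \sum_(m < r)
     (T (theta_ u ^+ m * theta_ v ^- m)%g + T (theta_ u ^- m * theta_ v ^+ m)%g).

Inductive HH_rel : F -> F -> Prop :=
| HH_rel_ee i j : HH_rel (E i * E j - E j * E i) 0
| HH_rel_t1 : HH_rel (T 1%g) 1
| HH_rel_tM g h : HH_rel (T g * T h) (T (g * h)%g)
| HH_rel_theta i j : HH_rel (T (theta_ i) * E j) (E j * T (theta_ i))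
| HH_rel_transp_far (j j' i : 'I_n) of j' = j.+1 :> nat & i != j & i != j' :
  HH_rel (T (transp_ j j') * E i) (E i * T (transp_ j j'))
| HH_rel_transp (i i' : 'I_n) of i' = i.+1 :> nat :
  HH_rel (T (transp_ i i') * E i) (E i' * T (transp_ i i') - c_tilde i i').

Definition HH_alg := pres_alg HH_rel.
Definition HH_e (i : 'I_n) : HH_alg := pres_pi HH_rel (E i).
Definition HH_t (g : G0) : HH_alg := pres_pi HH_rel (T g).

End GradedHeckeAlgebra.

(* Main.v *)
Require Import Defs.
From HB Require Import structures.
From mathcomp Require Import all_boot all_order all_fingroup all_algebra.
From mathcomp Require Import finmap boolp functions reals complex.
From mathcomp Require Import ring zify.
From mathcomp.multinomials Require Import monalg mpoly.

Set Implicit Arguments.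
Unset Strict Implicit.
Unset Printing Implicit Defensive.

Import Order.TTheory GRing.Theory Num.Theory.
Local Open Scope ring_scope.

(** Write z_i = v_i alpha_i and K_ij = k_0 sum_m s_ij^[m].  The cross relation
    of the symplectic reflection algebra gives, for i != j,
    [v_i, alpha_j] = k_0 sum_m xi^(-m) s_ij^[m], hence
    [z_i, z_j] = (z_j - z_i) K_ij (euler_bracket).  An element g of G permutes
    the coordinate lines by some sigma, so that g z_i = z_(sigma i) g and
    g K_ij = K_(sigma i)(sigma j) g.  These rules show that adding to z_j the
    Jucys-Murphy element sum_(i < j) K_ij yields commuting elements
    (opdam_commute), and that s_(i,i+1) exchanges consecutive ones up to
    K_(i,i+1) s_(i,i+1) (Hg_opdam_near): these are the relations of the graded
    Hecke algebra.  Since K_ij is k~_ij s_ij^[0] (class_sum_factor), the elements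
    obtained are the D_j, the homomorphism of the theorem exists (hecke_map), and
    its image contains G and z_j = D_j - sum_(i < j) K_ij, so that it is all of
    D(G,k).

    Injectivity is a Poincare-Birkhoff-Witt argument.  On one side, the monomials
    e^m t_g span the Hecke algebra (HH_pbw), because t_g e_i - e_(sigma i) t_g
    lies in the span of the group.  On the other side, the elements D^m g are
    linearly independent, which is seen in a representation of the symplectic
    reflection algebra by Dunkl operators (H_alg_representation).  It acts on
    functions of a level in nat and of a matrix with values in C[x_1, ..., x_n];
    a vector y acts by the Dunkl operator plus a term that raises the level by
    one and multiplies by a scalar, as if y acted on an inducing module through a
    formal large parameter.  Therefore D_i raises the level by at most one, and
    at the top level and at the matrices of the group it is multiplication by a
    nonzero multiple of x_i.  Applied to a vector concentrated at level 0 and at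
    the identity matrix, D^m g is at level |m| a nonzero multiple of x^m
    concentrated at g^-1, and a linear relation is refuted by looking at a
    monomial of maximal degree (pbw_independent).

    The commutation of the Dunkl operators (dunkl_opC) follows from their
    commutators with the coordinates: by the Jacobi identity [T_y, T_y'] commutes
    with all of them, and it kills the functions that are constant in x.

    All computations with generators and relations take place in an arbitrary
    ring A, with a central homomorphism iota from the scalars instead of a
    scaling: presented algebras are rings that may be zero, and the scalars act
    on them through c |-> c *: 1. *)

(** * Universal property of algebras given by generators and relations *)

Section FreeLift.
Variables (K : comNzRingType) (X : choiceType) (B : pzRingType).
Variables (iota : {rmorphism K -> B}) (f : X -> B).
Hypothesis iotaC : forall c b, iota c * b = b * iota c.
Local Notation F := (free_alg K X).
Local Notation msupp := (@monalg.msupp _ K).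
Local Notation mcoeff := (@monalg.mcoeff _ K).

Definition word_lift (w : monalg.fmonom X) : B :=
  \prod_(x <- monalg.fmonom_val w) f x.

Definition free_lift (a : F) : B :=
  \sum_(w <- msupp a) iota (mcoeff w a) * word_lift w.

Lemma free_lift_wide (d : {fset monalg.fmonom X}) (a : F) :
  fsubset (msupp a) d ->
  free_lift a = \sum_(w <- d) iota (mcoeff w a) * word_lift w.
Proof.
move=> le; rewrite /free_lift (big_fset_incl _ le) //= => w _.
by move/monalg.mcoeff_outdom=> ->; rewrite rmorph0 mul0r.
Qed.

Lemma free_liftB : zmod_morphism free_lift.
Proof.
move=> a b; set d := (msupp a `|` msupp b `|` msupp (a - b))%fset.
have sub c : c \in [:: a; b; a - b] -> fsubset (msupp c) d.
  rewrite !inE => cE; apply/fsubsetP => w wc; rewrite !inE.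
  by case/or3P: cE wc => /eqP-> ->; rewrite ?orbT.
rewrite !(@free_lift_wide d) ?sub ?inE ?eqxx ?orbT //.
by rewrite -sumrB; apply: eq_bigr => w _; rewrite monalg.mcoeffB rmorphB mulrBl.
Qed.

Lemma free_liftU c w :
  free_lift (monalg.mkmalgU w c : F) = iota c * word_lift w.
Proof.
rewrite (@free_lift_wide [fset w]%fset); last exact: monalg.msuppU_le.
by rewrite big_seq_fset1 monalg.mcoeffU eqxx mulr1n.
Qed.

HB.instance Definition _ :=
  GRing.isZmodMorphism.Build F B free_lift free_liftB.

Lemma free_liftM : {morph free_lift : a b / a * b}.
Proof.
move=> a b; rewrite monalg.malgME raddf_sum /= mulr_suml.
apply: eq_bigr => v _; rewrite raddf_sum mulr_sumr; apply: eq_bigr => w _ /=.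
rewrite free_liftU rmorphM -!mulrA; congr (_ * _).
by rewrite [RHS]mulrA -iotaC -mulrA /word_lift monalg.fmM big_cat.
Qed.

Lemma free_lift1 : free_lift 1 = 1.
Proof.
by rewrite free_liftU rmorph1 mul1r /word_lift monalg.fm1 big_nil.
Qed.

HB.instance Definition _ :=
  GRing.isMonoidMorphism.Build F B free_lift (conj free_lift1 free_liftM).

Lemma free_lift_gen x : free_lift (free_gen K x) = f x.
Proof.
by rewrite free_liftU rmorph1 mul1r /word_lift monalg.fmU big_seq1.
Qed.

Lemma free_liftZ c a : free_lift (c *: a) = iota c * free_lift a.
Proof.
rewrite (@free_lift_wide (msupp a)); last exact: monalg.msuppZ_le.
rewrite /free_lift mulr_sumr; apply: eq_bigr => w _.
by rewrite monalg.mcoeffZ rmorphM mulrA.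
Qed.

Section PresLift.
Variable rel : F -> F -> Prop.
Hypothesis free_lift_rel : forall a b, rel a b -> free_lift a = free_lift b.

Definition pres_lift (a : pres_alg rel) : B := free_lift (generic_quotient.repr a).

(** The set of elements killed by a ring homomorphism is a two-sided ideal: it
    contains the ideal of relations as soon as it contains the relations, so the
    value does not depend on the representative. *)
Lemma pres_lift_pi a : pres_lift (pres_pi rel a) = free_lift a.
Proof.
apply/eqP; rewrite -subr_eq0 -raddfB; apply/eqP.
have /pres_piP : pres_pi rel (generic_quotient.repr (pres_pi rel a)) = pres_pi rel a.
  exact: generic_quotient.reprK.
elim=> {a} [a b /free_lift_rel ab||a b _ a0 _ b0|c a _ a0|c a _ a0].
- by rewrite raddfB /= ab subrr.
- exact: raddf0.
- by rewrite raddfD /= a0 b0 addr0.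
- by rewrite /= free_liftM a0 mulr0.
- by rewrite /= free_liftM a0 mul0r.
Qed.

Fact pres_lift_zmod_morphism : zmod_morphism pres_lift.
Proof.
move=> a b; have [[a' ->] [b' ->]] := (pres_pi_surj a, pres_pi_surj b).
by rewrite -raddfB !pres_lift_pi raddfB.
Qed.

Fact pres_lift_monoid_morphism : monoid_morphism pres_lift.
Proof.
split=> [|a b]; first by rewrite -(rmorph1 (pres_pi rel)) pres_lift_pi free_lift1.
have [[a' ->] [b' ->]] := (pres_pi_surj a, pres_pi_surj b).
by rewrite -rmorphM !pres_lift_pi free_liftM.
Qed.

HB.instance Definition _ :=
  GRing.isZmodMorphism.Build (pres_alg rel) B pres_lift pres_lift_zmod_morphism.
HB.instance Definition _ :=
  GRing.isMonoidMorphism.Build (pres_alg rel) B pres_lift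
    pres_lift_monoid_morphism.

Lemma pres_liftZ c a : pres_lift (c *: a) = iota c * pres_lift a.
Proof.
have [a' ->] := pres_pi_surj a.
by rewrite -linearZ !pres_lift_pi free_liftZ.
Qed.

Lemma pres_lift_morphism : exists phi : {rmorphism pres_alg rel -> B},
    (forall c a, phi (c *: a) = iota c * phi a) /\
    (forall x, phi (pres_pi rel (free_gen K x)) = f x).
Proof.
exists pres_lift; split=> [c a|x]; first exact: pres_liftZ.
by rewrite /= pres_lift_pi free_lift_gen.
Qed.

End PresLift.

(** The relations are to be checked for a ring homomorphism phi on the free
    algebra known only by its values on scalars and generators, so that a check
    never refers to the sum over words that defines it. *)
Lemma pres_alg_universal (rel : F -> F -> Prop) :
  (forall phi : {rmorphism F -> B},
     (forall c a, phi (c *: a) = iota c * phi a) ->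
     (forall x, phi (free_gen K x) = f x) ->
   forall a b, rel a b -> phi a = phi b) ->
  exists phi : {rmorphism pres_alg rel -> B},
    (forall c a, phi (c *: a) = iota c * phi a) /\
    (forall x, phi (pres_pi rel (free_gen K x)) = f x).
Proof.
by move=> relP; apply/pres_lift_morphism/relP; [exact: free_liftZ|exact: free_lift_gen].
Qed.

End FreeLift.

(** * The ring of endomorphisms of a module *)

Section Endomorphisms.
Variables (K : comNzRingType) (M : lmodType K).

Record endo : Type := Endo { endo_fun :> M -> M; endo_lin : linear endo_fun }.

HB.instance Definition _ := gen_eqMixin endo.
HB.instance Definition _ := gen_choiceMixin endo.

Lemma endoP (f g : endo) : f =1 g -> f = g.
Proof.
case: f g => [f fL] [g gL] /= /funext fg.
by case: g / fg gL => gL; congr Endo; exact: Prop_irrelevance.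
Qed.

Fact endo_zero_lin : linear (fun _ : M => 0 : M).
Proof. by move=> c u v; rewrite scaler0 addr0. Qed.
Fact endo_opp_lin (f : endo) : linear (fun u => - f u).
Proof. by move=> c u v; rewrite endo_lin opprD scalerN. Qed.
Fact endo_add_lin (f g : endo) : linear (fun u => f u + g u).
Proof. by move=> c u v; rewrite !endo_lin scalerDr addrACA. Qed.
Fact endo_one_lin : linear (fun u : M => u).
Proof. by []. Qed.
Fact endo_mul_lin (f g : endo) : linear (fun u => f (g u)).
Proof. by move=> c u v; rewrite !endo_lin. Qed.
Fact endo_scale_lin (a : K) : linear (fun u : M => a *: u).
Proof. by move=> c u v; rewrite scalerDr !scalerA mulrC. Qed.

Definition endo_add f g := Endo (endo_add_lin f g).
Definition endo_mul f g := Endo (endo_mul_lin f g).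

Fact endo_addA : associative endo_add.
Proof. by move=> f g h; apply: endoP => u /=; rewrite addrA. Qed.
Fact endo_addC : commutative endo_add.
Proof. by move=> f g; apply: endoP => u /=; rewrite addrC. Qed.
Fact endo_add0 : left_id (Endo endo_zero_lin) endo_add.
Proof. by move=> f; apply: endoP => u /=; rewrite add0r. Qed.
Fact endo_addN : left_inverse (Endo endo_zero_lin)
  (fun f => Endo (endo_opp_lin f)) endo_add.
Proof. by move=> f; apply: endoP => u /=; rewrite addNr. Qed.

HB.instance Definition _ := GRing.isZmodule.Build endo
  endo_addA endo_addC endo_add0 endo_addN.

Lemma endoD (f g : endo) u : (f + g) u = f u + g u. Proof. by []. Qed.
Lemma endoN (f : endo) u : (- f) u = - f u. Proof. by []. Qed.

HB.instance Definition _ (f : endo) :=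
  GRing.isLinear.Build K M M *:%R f (@endo_lin f).

Fact endo_mulA : associative endo_mul. Proof. by move=> *; apply: endoP. Qed.
Fact endo_mul1l : left_id (Endo endo_one_lin) endo_mul.
Proof. by move=> *; apply: endoP. Qed.
Fact endo_mul1r : right_id (Endo endo_one_lin) endo_mul.
Proof. by move=> *; apply: endoP. Qed.
Fact endo_mulDl : left_distributive endo_mul +%R.
Proof. by move=> *; apply: endoP. Qed.
Fact endo_mulDr : right_distributive endo_mul +%R.
Proof. by move=> f g h; apply: endoP => u /=; rewrite raddfD. Qed.

HB.instance Definition _ := GRing.Zmodule_isPzRing.Build endo
  endo_mulA endo_mul1l endo_mul1r endo_mulDl endo_mulDr.

Lemma endoM (f g : endo) u : (f * g) u = f (g u). Proof. by []. Qed.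
Lemma endo_sum (I : Type) (r : seq I) P (f : I -> endo) u :
  (\sum_(i <- r | P i) f i) u = \sum_(i <- r | P i) f i u.
Proof. by elim/big_rec2: _ => // i y z _ <-. Qed.

Definition endo_scalar (c : K) : endo := Endo (endo_scale_lin c).

Fact endo_scalarB : zmod_morphism endo_scalar.
Proof. by move=> c d; apply: endoP => u; rewrite /= scalerBl. Qed.
Fact endo_scalarM : monoid_morphism endo_scalar.
Proof.
by split=> [|c d]; apply: endoP => u; rewrite /= ?scale1r ?scalerA.
Qed.
HB.instance Definition _ :=
  GRing.isZmodMorphism.Build K endo endo_scalar endo_scalarB.
HB.instance Definition _ :=
  GRing.isMonoidMorphism.Build K endo endo_scalar endo_scalarM.

Lemma endo_scalarC c (f : endo) : endo_scalar c * f = f * endo_scalar c.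
Proof. by apply: endoP => u; rewrite !endoM /= linearZ. Qed.

End Endomorphisms.

(** * Scalars, induction and subalgebras in a presented algebra *)

Section PresentedAlgebraScalars.
Variables (K : comNzRingType) (X : choiceType).
Variable rel : free_alg K X -> free_alg K X -> Prop.
Local Notation A := (pres_alg rel).

Definition pres_scalar (c : K) : A := c *: (1 : A).

Lemma pres_scalarE c a : c *: a = pres_scalar c * a.
Proof. by rewrite -pres_scalerAl mul1r. Qed.

Lemma pres_scalarC c a : pres_scalar c * a = a * pres_scalar c.
Proof. by rewrite -pres_scalerAl -pres_scalerAr mul1r mulr1. Qed.

Fact pres_scalar_zmod_morphism : zmod_morphism pres_scalar.
Proof. by move=> c d; rewrite /pres_scalar scalerBl. Qed.

Fact pres_scalar_monoid_morphism : monoid_morphism pres_scalar.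
Proof.
by split=> [|c d]; rewrite /pres_scalar ?scale1r // -pres_scalerAl mul1r scalerA.
Qed.

HB.instance Definition _ :=
  GRing.isZmodMorphism.Build K A pres_scalar pres_scalar_zmod_morphism.
HB.instance Definition _ :=
  GRing.isMonoidMorphism.Build K A pres_scalar pres_scalar_monoid_morphism.

Lemma pres_pi_scalar c a :
  pres_pi rel (c *: a) = pres_scalar c * pres_pi rel a.
Proof. by rewrite linearZ /= pres_scalarE. Qed.

(** Words in the generators span the free algebra, and a word is built from 1 by
    multiplication on the left by generators. *)
Lemma pres_gen_ind (P : A -> Prop) :
  P 0 -> P 1 -> (forall c a b, P a -> P b -> P (pres_scalar c * a + b)) ->
  (forall x a, P a -> P (pres_pi rel (free_gen K x) * a)) -> forall a, P a.
Proof.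
move=> P0 P1 PD PX a; have [b ->] := pres_pi_surj a.
rewrite (monalg.monalgE b) raddf_sum /=; elim/big_rec: _ => // w y _ Py.
have -> : monalg.mkmalgU w (monalg.mcoeff w b)
          = monalg.mcoeff w b *: (monalg.mkmalgU w 1 : free_alg K X).
  by apply/monalg.malgP => v; rewrite monalg.mcoeffZ !monalg.mcoeffU mulrnAr mulr1.
rewrite linearZ /= pres_scalarE; apply: PD Py => {b y}.
case: w => s; elim: s => [|x s IHs].
  have -> : monalg.mkmalgU (monalg.FMonom [::]) 1 = 1 :> free_alg K X.
    by rewrite -monalg.fmoneE.
  by rewrite rmorph1.
have -> : monalg.mkmalgU (monalg.FMonom (x :: s)) 1
   = free_gen K x * (monalg.mkmalgU (monalg.FMonom s) 1) :> free_alg K X.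
  rewrite /free_gen [RHS]monalg.malgM_def monalg.fgmulUU mulr1; congr monalg.mkmalgU.
  by apply: val_inj; rewrite /= monalg.fmM monalg.fmU.
by rewrite rmorphM; apply: PX.
Qed.

End PresentedAlgebraScalars.

Section Corestriction.
Variables (K : comNzRingType) (X : choiceType).
Variable rel : free_alg K X -> free_alg K X -> Prop.
Variable S : pres_alg rel -> Prop.
Variables (B : pzRingType) (psi : {rmorphism B -> pres_alg rel}).
Hypothesis psi_in : forall b, psi b \in subalg_pred S.

Definition corestrict (b : B) : subalg S := Subalg (psi_in b).

Fact corestrict_zmod_morphism : zmod_morphism corestrict.
Proof. by move=> a b; apply: val_inj; rewrite /= !rmorphB. Qed.

Fact corestrict_monoid_morphism : monoid_morphism corestrict.
Proof.
by split=> [|a b]; apply: val_inj; rewrite /= ?rmorph1 // !rmorphM.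
Qed.

HB.instance Definition _ := GRing.isZmodMorphism.Build B (subalg S) corestrict
  corestrict_zmod_morphism.
HB.instance Definition _ := GRing.isMonoidMorphism.Build B (subalg S) corestrict
  corestrict_monoid_morphism.

Lemma corestrict_morphism : exists phi : {rmorphism B -> subalg S},
  forall b, subalg_val (phi b) = psi b.
Proof. by exists corestrict. Qed.

End Corestriction.

Section BijectiveOntoSubalgebra.
Variables (K : comNzRingType) (X : choiceType).
Variable rel : free_alg K X -> free_alg K X -> Prop.
Variables (S : pres_alg rel -> Prop) (X' : choiceType).
Variable rel' : free_alg K X' -> free_alg K X' -> Prop.
Variable psi : {rmorphism pres_alg rel' -> pres_alg rel}.
Hypothesis psiZ : forall c b, psi (c *: b) = pres_scalar rel c * psi b.
Hypothesis psi_gen : forall x, in_subalg S (psi (pres_pi rel' (free_gen K x))).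
Hypothesis psi_surj : forall a, S a -> exists b, psi b = a.
Hypothesis psi_inj : forall b, psi b = 0 -> b = 0.

(** The inverse of the bijection is obtained by choice from surjectivity, which
    holds because the image of an algebra homomorphism is a subalgebra. *)
Lemma isomorphism_onto_subalg : exists phi : {rmorphism pres_alg rel' -> subalg S},
  [/\ scalable phi, bijective phi & forall b, subalg_val (phi b) = psi b].
Proof.
have psi_in b : psi b \in subalg_pred S.
  elim/pres_gen_ind: b => [|| c a b Ia Ib|x a Ia].
  - by rewrite rmorph0 rpred0.
  - by rewrite rmorph1 rpred1.
  - rewrite -pres_scalarE rmorphD /= psiZ -pres_scalarE; apply: rpredD => //.
    by apply/subalg_predP/in_subalgZ/subalg_predP.
  rewrite rmorphM /=; apply: rpredM => //; exact/subalg_predP.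
have [phi phiE] := corestrict_morphism psi_in.
exists phi; split=> //.
  by move=> c b; apply: val_inj; rewrite /= !phiE psiZ -pres_scalarE.
have surj a : in_subalg S a -> exists b, psi b = a.
  elim=> {a} [a /psi_surj//||a a' _ [b <-] _ [b' <-]|a a' _ [b <-] _ [b' <-]|c a _ [b <-]].
  - by exists 1; rewrite rmorph1.
  - by exists (b + b'); rewrite rmorphD.
  - by exists (b * b'); rewrite rmorphM.
  by exists (c *: b); rewrite psiZ -pres_scalarE.
have surj' (a : subalg S) : exists b, phi b = a.
  have [b bE] := surj _ (subalg_predP _ _ (subalg_valP a)).
  by exists b; apply: val_inj; rewrite /= phiE.
exists (fun a => sval (cid (surj' a))) => [b|a]; last by case: cid.
case: cid => /= b' b'E; apply/eqP; rewrite -subr_eq0; apply/eqP/psi_inj.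
by rewrite rmorphB /= -!phiE b'E subrr.
Qed.

End BijectiveOntoSubalgebra.

(** * Linear substitutions, derivatives and divided differences *)

Section Polynomials.
Variables (C : fieldType) (n : nat).
Local Notation A := (mpoly n C).

Definition lin (u : 'rV[C]_n) : A := \sum_i u 0 i *: 'X_i.

Fact lin_linear : linear lin.
Proof.
move=> a u v; rewrite /lin scaler_sumr -big_split /=; apply: eq_bigr => i _.
by rewrite !mxE scalerDl scalerA.
Qed.
HB.instance Definition _ :=
  GRing.isLinear.Build C 'rV[C]_n A *:%R lin lin_linear.

Lemma lin_delta i : lin (delta_mx 0 i) = 'X_i.
Proof.
rewrite /lin (bigD1 i) //= mxE !eqxx scale1r big1 ?addr0 // => j /negPf ji.
by rewrite mxE ji andbF scale0r.
Qed.

Lemma lin_eq0 u : (lin u == 0) = (u == 0).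
Proof.
apply/eqP/eqP=> [u0|->]; last exact: raddf0.
apply/rowP => i; rewrite mxE; have := congr1 (mcoeff U_(i)%MM) u0.
rewrite mcoeff0 /lin raddf_sum /= (bigD1 i) //= big1 => [|j /negPf ji].
  by rewrite addr0 mcoeffZ mcoeffXU eqxx mulr1.
by rewrite mcoeffZ mcoeffXU ji mulr0.
Qed.

(** The induction by which an identity between linear operators on polynomials
    follows from its behaviour on 1 and under multiplication by a coordinate. *)
Lemma mpoly_gen_ind (P : A -> Prop) :
  P 1 -> (forall c p q, P p -> P q -> P (c *: p + q)) ->
  (forall i p, P p -> P ('X_i * p)) -> forall p, P p.
Proof.
move=> P1 PD PX.
have P0 : P 0 by rewrite -[0](addNr 1) -scaleN1r; apply: PD.
elim/mpolyind => // c m p _ _; apply: PD; rewrite mpolyXE_id.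
elim/big_rec: _ => // i q _ Pq; elim: (m i) => [|k IHk]; first by rewrite mul1r.
by rewrite exprS -mulrA; apply: PX.
Qed.

(** The algebra endomorphism that acts on linear forms, seen as rows, by right
    multiplication by B; the action of a linear map g on functions is
    subst (invmx g). *)
Definition subst (B : 'M[C]_n) (p : A) : A :=
  comp_mpoly [tuple lin (row i B) | i < n] p.

HB.instance Definition _ B := GRing.Linear.copy (subst B)
  (comp_mpoly [tuple lin (row i B) | i < n]).
HB.instance Definition _ B := GRing.RMorphism.copy (subst B)
  (comp_mpoly [tuple lin (row i B) | i < n]).

Lemma subst_lin B u : subst B (lin u) = lin (u *m B).
Proof.
have -> : u *m B = \sum_i u 0 i *: row i B.
  by rewrite mulmx_sum_row.
rewrite !linear_sum /=; apply: eq_bigr => i _; rewrite !linearZ /=.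
by rewrite /subst comp_mpolyXU -tnth_nth tnth_mktuple.
Qed.

Lemma substX B i : subst B 'X_i = lin (row i B).
Proof. by rewrite -lin_delta subst_lin -rowE. Qed.

Lemma subst_comp B B' p : subst B (subst B' p) = subst (B' *m B) p.
Proof.
elim/mpoly_gen_ind: p => [|c p q IHp IHq|i p IHp]; first by rewrite !rmorph1.
  by rewrite !linearP /= IHp IHq.
by rewrite !rmorphM /= IHp !substX subst_lin row_mul.
Qed.

Lemma subst_id p : subst 1%:M p = p.
Proof.
elim/mpoly_gen_ind: p => [|c p q IHp IHq|i p IHp]; first by rewrite !rmorph1.
  by rewrite !linearP /= IHp IHq.
by rewrite !rmorphM /= IHp substX row1 lin_delta.
Qed.

(** The derivative along the constant vector field v. *)
Definition pder (v : 'cV[C]_n) (p : A) : A := \sum_i v i 0 *: mderiv i p.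

Fact pder_linear v : linear (pder v).
Proof.
move=> a p q; rewrite /pder scaler_sumr -big_split /=; apply: eq_bigr => i _.
by rewrite linearP scalerDr !scalerA mulrC.
Qed.
HB.instance Definition _ v :=
  GRing.isLinear.Build C A A *:%R (pder v) (pder_linear v).

Lemma pder_linl a v w p : pder (a *: v + w) p = a *: pder v p + pder w p.
Proof.
rewrite /pder scaler_sumr -big_split /=; apply: eq_bigr => i _.
by rewrite !mxE scalerDl scalerA.
Qed.

Lemma pderM v p q : pder v (p * q) = pder v p * q + p * pder v q.
Proof.
rewrite /pder mulr_suml mulr_sumr -big_split /=; apply: eq_bigr => i _.
by rewrite mderivM scalerDr scalerAl scalerAr.
Qed.

Lemma pder_lin v u : pder v (lin u) = ((u *m v) 0 0)%:MP.
Proof.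
rewrite /pder mxE rmorph_sum /=; apply: eq_bigr => i _.
rewrite /lin (linear_sum (mderiv i)) (bigD1 i) //= big1 => [|j /negPf ji].
  rewrite addr0 linearZ /= mderivX mnm1E eqxx mulr1n.
  by rewrite -{1}[U_(i)%MM]add0m addmK mpolyX0 !scalerA ?mulr1 mulrC alg_mpolyC.
by rewrite linearZ /= mderivX mnm1E ji scale0r scaler0.
Qed.

Lemma pder1 v : pder v 1 = 0.
Proof. by rewrite /pder big1 // => i _; rewrite -mpolyC1 mderivC scaler0. Qed.

Lemma pder_subst v B p : pder v (subst B p) = subst B (pder (B *m v) p).
Proof.
elim/mpoly_gen_ind: p => [|c p q IHp IHq|i p IHp].
- by rewrite rmorph1 !pder1 raddf0.
- by rewrite !linearP /= IHp IHq.
rewrite rmorphM /= !pderM IHp -lin_delta subst_lin !pder_lin rmorphD !rmorphM /=.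
by rewrite subst_lin mulmxA /subst comp_mpolyC.
Qed.

(** A linear form u is sent to u - (u w) al by the substitution 1 - w al: it
    moves by a multiple of al.  The set of polynomials that move by a multiple of
    al is closed under products, since
    p q - p' q' = p (q - q') + (p - p') q'. *)
Lemma divdiff_exists (al : 'rV[C]_n) (w : 'cV[C]_n) (p : A) :
  exists q, lin al * q = p - subst (1%:M - w *m al) p.
Proof.
elim/mpoly_gen_ind: p => [|c p p' [q IHp] [q' IHp']|i p [q IHp]].
- by exists 0; rewrite rmorph1 subrr mulr0.
- exists (c *: q + q').
  by rewrite linearP /= mulrDr IHp' -scalerAr IHp scalerBr opprD addrACA.
exists ('X_i * q + w i 0 *: subst (1%:M - w *m al) p).
rewrite mulrDr mulrCA IHp rmorphM /= -scalerAr scalerAl -linearZ /=.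
have -> : w i 0 *: al = row i (1%:M) - row i (1%:M - w *m al).
  by rewrite linearB /= subKr row_mul; apply/rowP => j; rewrite !mxE big_ord1 !mxE.
by rewrite linearB /= row1 lin_delta substX mulrBr mulrBl subrKA.
Qed.

(** For a reflection s with s^-1 = 1 - w al, this is (p - s p) / al, the
    difference quotient of the Dunkl operators. *)
Definition divdiff al w p : A := sval (cid (divdiff_exists al w p)).

Lemma divdiffE al w p :
  lin al * divdiff al w p = p - subst (1%:M - w *m al) p.
Proof. by rewrite /divdiff; case: cid. Qed.

Lemma divdiff_uniq al w p q : al != 0 ->
  lin al * q = p - subst (1%:M - w *m al) p -> divdiff al w p = q.
Proof.
move=> al0 qE; apply: (mulfI (_ : lin al != 0)); first by rewrite lin_eq0.
by rewrite divdiffE.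
Qed.

Lemma divdiff_linear al w : al != 0 -> linear (divdiff al w).
Proof.
move=> al0 c p q; apply: divdiff_uniq => //.
by rewrite linearP /= mulrDr -scalerAr !divdiffE scalerBr opprD addrACA.
Qed.

(** The twisted Leibniz rule; its second term produces the reflections in the
    commutator of a Dunkl operator with a coordinate. *)
Lemma divdiff_lin al w u p : al != 0 ->
  divdiff al w (lin u * p)
  = lin u * divdiff al w p + (u *m w) 0 0 *: subst (1%:M - w *m al) p.
Proof.
move=> al0; apply: divdiff_uniq => //.
rewrite mulrDr mulrCA divdiffE rmorphM /= -scalerAr scalerAl -linearZ /=.
have -> : (u *m w) 0 0 *: al = u - u *m (1%:M - w *m al).
  by rewrite mulmxBr mulmx1 subKr mulmxA [u *m w]mx11_scalar mul_scalar_mx !mxE eqxx mulr1n.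
by rewrite linearB /= -subst_lin mulrBr mulrBl subrKA.
Qed.

Lemma divdiffC al w a : al != 0 -> divdiff al w (a *: 1) = 0.
Proof.
by move=> al0; apply: divdiff_uniq => //; rewrite mulr0 linearZ /= rmorph1 subrr.
Qed.

(** A substitution D that conjugates one reflection into another and carries one
    root to z times the other intertwines the quotients, up to the factor
    z^-1 by which the denominators differ. *)
Lemma divdiff_subst D al w al' w' z p : al' != 0 -> z != 0 ->
  al *m D = z *: al' ->
  (1%:M - w *m al) *m D = D *m (1%:M - w' *m al') ->
  subst D (divdiff al w p) = z^-1 *: divdiff al' w' (subst D p).
Proof.
move=> al0 z0 alD RD; apply: (scalerI z0); rewrite scalerA divff // scale1r.
apply/esym/divdiff_uniq => //.
rewrite -scalerAr scalerAl -linearZ /= -alD -subst_lin -rmorphM /= divdiffE raddfB /=.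
by rewrite !subst_comp RD.
Qed.

End Polynomials.

(** * The Dunkl representation of a reflection group *)

Lemma invmx_mul (C : fieldType) n (A B : 'M[C]_n) :
  A \in unitmx -> B \in unitmx -> invmx (A *m B) = invmx B *m invmx A.
Proof.
move=> AU BU; apply: (can_inj (mulKmx (_ : A *m B \in unitmx))).
  by rewrite unitmx_mul AU.
by rewrite mulmxV ?unitmx_mul ?AU // mulmxA mulmxK // mulmxV.
Qed.

(** The family of reflections is indexed by the j such that P j; c is the
    multiplicity of s j, and s j and its inverse are 1 - w' al and 1 - w al.  The
    vectors w and w' are the same for a reflection of order 2. *)
Section DunklRepresentation.
Variables (C : fieldType) (n : nat) (J : finType) (P : pred J) (c : J -> C).
Variables (s : J -> 'M[C]_n) (al : J -> 'rV[C]_n) (w w' : J -> 'cV[C]_n).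
Variable lam : 'rV[C]_n.
Hypothesis al0 : forall j, P j -> al j != 0.
Hypothesis sE : forall j, P j -> s j = 1%:M - w' j *m al j.
Hypothesis sK : forall j, P j -> s j *m (1%:M - w j *m al j) = 1%:M.

(** The level plays the part of the exponent of a formal parameter, and the
    matrix argument that of the group algebra in an induced module. *)
Definition dunkl_space : Type := nat -> 'M[C]_n -> (mpoly n C).
HB.instance Definition _ := GRing.Lmodule.on dunkl_space.
Local Notation M := dunkl_space.
Implicit Types (F : M) (k : nat) (H g : 'M[C]_n) (u : 'rV[C]_n) (y : 'cV[C]_n).

Lemma dunkl_spaceP F F' : (forall k H, F k H = F' k H) -> F = F'.
Proof. by move=> e; apply/funext => k; apply/funext => H. Qed.

Lemma dunkl_spaceE (a : C) F F' k H :
  (a *: F + F') k H = a *: F k H + F' k H.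
Proof. by []. Qed.

Lemma dunkl_space_sum (I : Type) (r : seq I) (Q : pred I) (f : I -> M) k H :
  (\sum_(i <- r | Q i) f i) k H = \sum_(i <- r | Q i) f i k H.
Proof. by elim/big_rec2: _ => // i x F _ <-. Qed.

Lemma scale_combination (V : lmodType C) a (p p' q q' r r' : V) :
  (a *: p + p') + (a *: q + q') - (a *: r + r')
  = a *: (p + q - r) + (p' + q' - r').
Proof.
by rewrite scalerBr scalerDr opprD (addrACA (a *: p)) (addrACA (a *: p + _)).
Qed.

(** Multiplication by the formal parameter. *)
Definition shift F : M := fun k H => if k is k'.+1 then F k' H else 0.

Definition mul_fun u F : M := fun k H => lin u * F k H.
Definition grp_fun g F : M := fun k H => subst (invmx g) (F k (H *m g)).
Definition refl_fun y F : M := fun k H =>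
  \sum_(j | P j) (c j * (al j *m y) 0 0)
    *: divdiff (al j) (w j) (F k (H *m s j)).
(** The Dunkl operator along y with values in the module induced from the
    character lam of the commuting vectors, multiplied by the formal parameter. *)
Definition dunkl_fun y F : M := fun k H =>
  pder y (F k H) + (lam *m H *m y) 0 0 *: shift F k H - refl_fun y F k H.

Fact mul_lin u : linear (mul_fun u).
Proof.
by move=> a F F'; apply: dunkl_spaceP => k H; rewrite /mul_fun !dunkl_spaceE mulrDr scalerAr.
Qed.
Fact grp_lin g : linear (grp_fun g).
Proof.
by move=> a F F'; apply: dunkl_spaceP => k H; rewrite /grp_fun !dunkl_spaceE linearP.
Qed.
Lemma shiftP (a : C) F F' k H :
  shift (a *: F + F') k H = a *: shift F k H + shift F' k H.
Proof. by case: k => [|k] //=; rewrite scaler0 addr0. Qed.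

Lemma refl_funP y (a : C) F F' k H :
  refl_fun y (a *: F + F') k H = a *: refl_fun y F k H + refl_fun y F' k H.
Proof.
rewrite /refl_fun scaler_sumr -big_split; apply: eq_bigr => j Pj.
by rewrite dunkl_spaceE divdiff_linear ?al0 // scalerDr !scalerA [a * _]mulrC.
Qed.

Fact dunkl_lin y : linear (dunkl_fun y).
Proof.
move=> a F F'; apply: dunkl_spaceP => k H; rewrite dunkl_spaceE /dunkl_fun.
rewrite refl_funP shiftP dunkl_spaceE pder_linear scalerDr.
by rewrite [_ *: (a *: _)]scalerA [_ * a]mulrC -[(a * _) *: _]scalerA scale_combination.
Qed.

Definition mul_op u : endo M := Endo (mul_lin u).
Definition grp_op g : endo M := Endo (grp_lin g).
Definition dunkl_op y : endo M := Endo (dunkl_lin y).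

Lemma mul_opP a u u' : mul_op (a *: u + u') = endo_scalar M a * mul_op u + mul_op u'.
Proof.
apply: endoP => F; apply: dunkl_spaceP => k H.
rewrite endoD endoM -[RHS]/(a *: (lin u * F k H) + lin u' * F k H).
by rewrite scalerAl -mulrDl -linearP.
Qed.

Lemma refl_fun_vecP a y y' F k H :
  refl_fun (a *: y + y') F k H = a *: refl_fun y F k H + refl_fun y' F k H.
Proof.
rewrite /refl_fun scaler_sumr -big_split; apply: eq_bigr => j Pj.
rewrite mulmxDr -scalemxAr [in X in _ * X]mxE [in X in X + _]mxE.
by rewrite mulrDr scalerDl scalerA mulrCA.
Qed.

Lemma dunkl_opP a y y' :
  dunkl_op (a *: y + y') = endo_scalar M a * dunkl_op y + dunkl_op y'.
Proof.
apply: endoP => F; apply: dunkl_spaceP => k H; rewrite endoD endoM.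
rewrite -[LHS]/(dunkl_fun (a *: y + y') F k H).
rewrite -[RHS]/(a *: dunkl_fun y F k H + dunkl_fun y' F k H) /dunkl_fun.
rewrite refl_fun_vecP pder_linl mulmxDr -scalemxAr.
by rewrite [in X in X *: shift _ _ _]mxE [in X in X + _]mxE scalerDl -scalerA scale_combination.
Qed.

Lemma grp_op1 : grp_op 1%:M = 1.
Proof.
apply: endoP => F; apply: dunkl_spaceP => k H.
by rewrite /= /grp_fun mulmx1 invmx1 subst_id.
Qed.

Lemma grp_opM g h : g \in unitmx -> h \in unitmx ->
  grp_op (g *m h) = grp_op g * grp_op h.
Proof.
move=> gU hU; apply: endoP => F; apply: dunkl_spaceP => k H.
by rewrite endoM /= /grp_fun subst_comp mulmxA invmx_mul.
Qed.

Lemma grp_mul_op g u : grp_op g * mul_op u = mul_op (u *m invmx g) * grp_op g.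
Proof.
apply: endoP => F; apply: dunkl_spaceP => k H.
by rewrite !endoM /= /grp_fun /mul_fun rmorphM /= subst_lin.
Qed.

Lemma mul_mul_op u u' : mul_op u * mul_op u' = mul_op u' * mul_op u.
Proof.
by apply: endoP => F; apply: dunkl_spaceP => k H; rewrite !endoM /= /mul_fun mulrCA.
Qed.

Lemma s_unit j : P j -> s j \in unitmx.
Proof. by move=> /sK /mulmx1_unit []. Qed.

Lemma s_inv j : P j -> invmx (s j) = 1%:M - w j *m al j.
Proof. by move=> Pj; rewrite -(mulKmx (s_unit Pj) (_ - _)) sK // mulmx1. Qed.

(** The contribution of the reflections to the commutator of the operator along
    y with the coordinate u. *)
Definition dunkl_comm u y : endo M :=
  \sum_(j | P j) endo_scalar M (c j * (al j *m y) 0 0 * (u *m w j) 0 0)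
    * grp_op (s j).

Lemma refl_fun_mul y u F k H :
  refl_fun y (mul_fun u F) k H
  = lin u * refl_fun y F k H + dunkl_comm u y F k H.
Proof.
rewrite /dunkl_comm endo_sum dunkl_space_sum /refl_fun mulr_sumr -big_split.
apply: eq_bigr => j Pj; rewrite {1}/mul_fun divdiff_lin ?al0 // scalerDr scalerAr.
by rewrite scalerA -s_inv.
Qed.

Lemma dunkl_mul_op y u :
  dunkl_op y * mul_op u - mul_op u * dunkl_op y
  = endo_scalar M ((u *m y) 0 0) - dunkl_comm u y.
Proof.
apply: endoP => F; apply: dunkl_spaceP => k H.
rewrite !endoD !endoN !endoM.
rewrite -[RHS]/(_ *: F k H - dunkl_comm u y F k H).
rewrite -[LHS]/(dunkl_fun y (mul_fun u F) k H - lin u * dunkl_fun y F k H).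
rewrite /dunkl_fun refl_fun_mul {1}/mul_fun pderM pder_lin mul_mpolyC.
have -> : shift (mul_fun u F) k H = lin u * shift F k H.
  by case: k => [|k] //=; rewrite mulr0.
rewrite mulrBr mulrDr -scalerAr.
move: (_ *: F k H) (lin u * pder _ _) (_ *: (lin u * _)) (lin u * refl_fun _ _ _ _).
move: (dunkl_comm _ _ _ _ _) => r p q t q'.
by apply/eqP; rewrite subr_eq; apply/eqP; rewrite -(addrA p) opprD [RHS](addrACA p) [- q' - r]addrC.
Qed.

(** Conjugation by g permutes the weighted reflections, and g carries their roots
    to one another up to scalars; stated with a permutation p of the index set
    because an index is not determined by the reflection. *)
Definition refl_invariant g := exists (p : J -> J) (z : J -> C),
  [/\ injective p, forall j, P (p j) = P j, forall j, c (p j) = c j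
    & forall j, P j -> [/\ z j != 0, al (p j) *m g = z j *: al j
                         & s (p j) *m g = g *m s j]].

Lemma refl_fun_grp g y F k H : g \in unitmx -> refl_invariant g ->
  subst (invmx g) (refl_fun y F k (H *m g)) = refl_fun (g *m y) (grp_fun g F) k H.
Proof.
move=> gU [p [z [p_inj pP pc pE]]].
rewrite /refl_fun linear_sum /= [RHS](reindex_inj p_inj) /=.
apply: eq_big => [j|j Pj]; first by rewrite pP.
have [z0 alE spE] := pE _ Pj; rewrite linearZ /= pc mulmxA alE -scalemxAl.
rewrite [in RHS]mxE /grp_fun -[H *m s _ *m g]mulmxA spE mulmxA.
rewrite (@divdiff_subst _ _ (invmx g) _ (w j) (al (p j)) (w (p j)) (z j)^-1) //.
- by rewrite scalerA invrK -mulrA [_ * z j]mulrC.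
- by rewrite al0 ?pP.
- by rewrite invr_eq0.
- apply: (can_inj (mulmxK gU)); rewrite mulmxKV // -scalemxAl alE.
  by rewrite scalerA mulVf // scale1r.
by rewrite -!s_inv ?pP // -!invmx_mul ?spE ?s_unit ?pP.
Qed.

(** The sum over reflections is unchanged when it is reindexed by conjugation by
    g; the scalar z of a root in the pairing with y cancels the factor z^-1 of the
    divided difference. *)
Lemma grp_dunkl_op g y : g \in unitmx -> refl_invariant g ->
  grp_op g * dunkl_op y = dunkl_op (g *m y) * grp_op g.
Proof.
move=> gU ginv; apply: endoP => F; apply: dunkl_spaceP => k H; rewrite !endoM.
rewrite -[LHS]/(subst (invmx g) (dunkl_fun y F k (H *m g))).
rewrite -[RHS]/(dunkl_fun (g *m y) (grp_fun g F) k H) /dunkl_fun.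
rewrite linearB linearD linearZ /= refl_fun_grp // {1}/grp_fun pder_subst mulKmx //.
rewrite -!mulmxA; congr (_ + _ *: _ - _).
by case: k => [|k] //=; rewrite raddf0.
Qed.

Hypothesis s_invariant : forall j, P j -> refl_invariant (s j).

(** Since s y' = y' - (al y') w', moving s across the operator along y' changes it
    by a multiple of the operator along w'.  The result is symmetric in y and y',
    which is what the Jacobi identity needs. *)
Lemma dunkl_comm_bracket u y y' :
  dunkl_comm u y * dunkl_op y' - dunkl_op y' * dunkl_comm u y
  = - \sum_(j | P j)
        endo_scalar M (c j * ((al j *m y) 0 0 * (al j *m y') 0 0) * (u *m w j) 0 0)
        * dunkl_op (w' j) * grp_op (s j).
Proof.
rewrite /dunkl_comm mulr_suml mulr_sumr -sumrB -sumrN; apply: eq_bigr => j Pj.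
rewrite -mulrA grp_dunkl_op ?s_unit //; last exact: s_invariant.
have -> : s j *m y' = (- (al j *m y') 0 0) *: w' j + y'.
  rewrite sE // mulmxBl mul1mx -mulmxA [al j *m y']mx11_scalar mul_mx_scalar.
  by rewrite scaleNr addrC !mxE eqxx mulr1n.
rewrite dunkl_opP mulrDl mulrDr [dunkl_op y' * (_ * _)]mulrA -endo_scalarC -!mulrA.
rewrite addrK !mulrA -rmorphM -!mulNr -rmorphN; congr (endo_scalar _ _ * _ * _).
by rewrite mulrN; congr (- _); rewrite -!mulrA [(u *m w j) 0 0 * _]mulrC.
Qed.

Definition dunkl_bracket y y' : endo M :=
  dunkl_op y * dunkl_op y' - dunkl_op y' * dunkl_op y.

(** The Jacobi identity: [[T, T'], u] = [[T, u], T'] - [[T', u], T], and the two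
    terms cancel by the symmetry in dunkl_comm_bracket. *)
Lemma dunkl_bracket_mul y y' u :
  dunkl_bracket y y' * mul_op u = mul_op u * dunkl_bracket y y'.
Proof.
have E z : dunkl_op z * mul_op u
    = mul_op u * dunkl_op z + endo_scalar M ((u *m z) 0 0) - dunkl_comm u z.
  by rewrite -addrA -dunkl_mul_op addrC subrK.
have step z z' : dunkl_op z * dunkl_op z' * mul_op u
  = mul_op u * (dunkl_op z * dunkl_op z')
    + (endo_scalar M ((u *m z) 0 0) * dunkl_op z'
       + endo_scalar M ((u *m z') 0 0) * dunkl_op z)
    - (dunkl_comm u z * dunkl_op z' + dunkl_op z * dunkl_comm u z').
  rewrite -mulrA E mulrBr mulrDr mulrA E mulrBl mulrDl -endo_scalarC !mulrA.
  by rewrite opprD !addrA; congr (_ - _); rewrite addrAC.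
have comm_sym : dunkl_comm u y * dunkl_op y' + dunkl_op y * dunkl_comm u y'
              = dunkl_comm u y' * dunkl_op y + dunkl_op y' * dunkl_comm u y.
  apply/eqP; rewrite -subr_eq addrAC eq_sym -subr_eq; apply/eqP.
  rewrite !dunkl_comm_bracket; congr (- _); apply: eq_bigr => j _.
  by rewrite [(al j *m y) 0 0 * _]mulrC.
rewrite /dunkl_bracket mulrBl (step y y') (step y' y) mulrBr comm_sym.
rewrite [endo_scalar M ((u *m y') 0 0) * _ + _]addrC.
by rewrite opprB addrA subrK opprD addrACA subrr addr0.
Qed.

(** The elementary tensor of a function constant in x with a polynomial. *)
Definition tensor (e : nat -> 'M[C]_n -> C) p : M := fun k H => e k H *: p.

(** Derivatives and divided differences kill the constants, so that only the
    character of the inducing module remains. *)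
Lemma dunkl_tensor1 y e :
  dunkl_op y (tensor e 1)
  = tensor (fun k H => (lam *m H *m y) 0 0 * if k is k'.+1 then e k' H else 0) 1.
Proof.
apply: dunkl_spaceP => k H; rewrite -[LHS]/(dunkl_fun y (tensor e 1) k H).
rewrite /dunkl_fun /tensor linearZ /= pder1 scaler0 add0r.
have -> : refl_fun y (fun k H => e k H *: 1) k H = 0.
  rewrite /refl_fun big1 // => j Pj.
  by rewrite divdiffC ?al0 // scaler0.
by rewrite subr0 -scalerA; case: k => [|k] //=; rewrite scale0r.
Qed.

Lemma dunkl_bracket_tensor y y' e p : dunkl_bracket y y' (tensor e p) = 0.
Proof.
elim/mpoly_gen_ind: p => [|a p q IHp IHq|i p IHp].
- rewrite endoD endoN !endoM !dunkl_tensor1; apply: dunkl_spaceP => k H.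
  rewrite -[LHS]/(tensor _ 1 k H - tensor _ 1 k H) /tensor.
  by case: k => [|[|k]]; rewrite ?mulr0 ?subrr // mulrCA subrr.
- have -> : tensor e (a *: p + q) = a *: tensor e p + tensor e q.
    apply: dunkl_spaceP => k H; rewrite dunkl_spaceE /tensor scalerDr.
    by rewrite !scalerA mulrC.
  by rewrite endo_lin IHp IHq scaler0 addr0.
have -> : tensor e ('X_i * p) = mul_op (delta_mx 0 i) (tensor e p).
  apply: dunkl_spaceP => k H.
  by rewrite -[RHS]/(lin _ * (e k H *: p)) lin_delta /tensor scalerAr.
by rewrite -endoM dunkl_bracket_mul endoM IHp raddf0.
Qed.

(** The points at which the argument of a Dunkl operator has to be known for its
    value at x to be determined. *)
Definition stencil (x : nat * 'M[C]_n) : seq (nat * 'M[C]_n) :=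
  (x.1, x.2) :: (x.1.-1, x.2) :: [seq (x.1, x.2 *m s j) | j : J].

Lemma dunkl_local y F F' k H :
  (forall k' H', (k', H') \in stencil (k, H) -> F k' H' = F' k' H') ->
  dunkl_op y F k H = dunkl_op y F' k H.
Proof.
move=> FF'; rewrite -[LHS]/(dunkl_fun y F k H) -[RHS]/(dunkl_fun y F' k H).
rewrite /dunkl_fun /refl_fun; apply: (f_equal2 (fun a b => a - b));
  first apply: (f_equal2 (fun a b => a + b)).
- by congr pder; apply: FF'; rewrite inE eqxx.
- by congr (_ *: _); case: k FF' => [|k] //= FF'; apply: FF'; rewrite !inE eqxx orbT.
apply: eq_bigr => j _; congr (_ *: divdiff _ _ _); apply: FF'.
by rewrite !inE; apply/orP; right; apply/orP; right; apply/imageP; exists j.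
Qed.

(** The bracket vanishes on elementary tensors.  A general function is an
    infinite sum of those, but the value at one point involves only finitely many
    of its values, hence only a finite sum. *)
Lemma dunkl_opC y y' : dunkl_op y * dunkl_op y' = dunkl_op y' * dunkl_op y.
Proof.
apply: endoP => F; apply: dunkl_spaceP => k H.
(* all the points on which the two composites depend at (k, H) *)
pose S := undup (flatten [seq stencil x | x <- stencil (k, H)]).
pose F' : M :=
  \sum_(x <- S) tensor (fun k H => ((k, H) == x)%:R) (F x.1 x.2).
have FF' k' H' : (k', H') \in S -> F k' H' = F' k' H'.
  move=> xS; rewrite /F' dunkl_space_sum (bigD1_seq (k', H')) ?undup_uniq //=.
  rewrite /tensor eqxx scale1r big1 ?addr0 // => x /negPf.
  by rewrite eq_sym => ->; rewrite scale0r.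
have loc z z' : dunkl_op z (dunkl_op z' F) k H = dunkl_op z (dunkl_op z' F') k H.
  apply: dunkl_local => k1 H1 in1; apply: dunkl_local => k2 H2 in2.
  by apply: FF'; rewrite mem_undup; apply/flatten_mapP; exists (k1, H1).
rewrite !endoM !loc; apply/eqP; rewrite -subr_eq0; apply/eqP.
rewrite -[LHS]/(dunkl_bracket y y' F' k H).
have -> : dunkl_bracket y y' F' = 0; last by [].
rewrite /F' linear_sum big1 // => x _; exact: dunkl_bracket_tensor.
Qed.

Definition supp_le d F := forall k H, (d < k)%N -> F k H = 0.

(** The filtration by level: f raises the level by at most m, and its effect on
    the top level is multiplication by sg. *)
Definition has_symbol m (sg : 'M[C]_n -> mpoly n C) (f : endo M) :=
  forall d F, supp_le d F ->
  supp_le (m + d) (f F) /\ forall H, f F (m + d)%N H = sg H * F d H.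

Lemma symbol1 : has_symbol 0 (fun=> 1) 1.
Proof. by move=> d F FS; split=> // H; rewrite mul1r. Qed.

Lemma symbolM m m' sg sg' f f' : has_symbol m sg f -> has_symbol m' sg' f' ->
  has_symbol (m + m') (fun H => sg H * sg' H) (f * f').
Proof.
move=> fS fS' d F FS; have [S' E'] := fS' _ _ FS; have [S E] := fS _ _ S'.
by rewrite endoM -addnA; split=> // H; rewrite E E' mulrA.
Qed.

Lemma symbolD m sg sg' f f' : has_symbol m sg f -> has_symbol m sg' f' ->
  has_symbol m (fun H => sg H + sg' H) (f + f').
Proof.
move=> fS fS' d F FS; have [S' E'] := fS' _ _ FS; have [S E] := fS _ _ FS.
split=> [k H dk|H]; rewrite -[LHS]/(f F _ H + f' F _ H) ?E ?E' ?mulrDl //.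
by rewrite S // S' // addr0.
Qed.

Lemma symbolZ m sg a f : has_symbol m sg f ->
  has_symbol m (fun H => a *: sg H) (endo_scalar M a * f).
Proof.
move=> fS d F FS; have [S E] := fS _ _ FS.
split=> [k H dk|H]; rewrite -[LHS]/(a *: f F _ H) ?E ?scalerAl //.
by rewrite S // scaler0.
Qed.

(** A group element preserves the level, so its symbol as an operator of order 1
    is zero. *)
Lemma symbol_grp g : has_symbol 1 (fun=> 0) (grp_op g).
Proof.
have S d F : supp_le d F -> supp_le d (grp_op g F).
  by move=> FS k H dk; rewrite -[LHS]/(subst _ (F k (H *m g))) FS // raddf0.
move=> d F /S FS; rewrite add1n; split=> [k H dk|H]; first by rewrite FS // ltnW.
by rewrite FS // mul0r.
Qed.

(** Derivatives and divided differences act at each level separately; only the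
    term with the shift reaches the next level. *)
Lemma symbol_dunkl_mul y u :
  has_symbol 1 (fun H => (lam *m H *m y) 0 0 *: lin u) (dunkl_op y * mul_op u).
Proof.
move=> d F FS; rewrite add1n endoM.
have {FS}[F' [F'E FS E]] : exists F', [/\ mul_op u F = F', supp_le d F'
    & forall H, F' d H = lin u * F d H].
  exists (mul_op u F); split=> // k H dk.
  by rewrite -[LHS]/(lin u * F k H) FS // mulr0.
have R0 k H : (d < k)%N -> refl_fun y F' k H = 0.
  move=> dk; rewrite /refl_fun big1 // => j Pj.
  have -> : F' k (H *m s j) = 0 *: 1 by rewrite FS // scale0r.
  by rewrite divdiffC ?al0 // scaler0.
have TE k H : (d < k)%N ->
    dunkl_op y F' k H = (lam *m H *m y) 0 0 *: shift F' k H.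
  move=> dk; rewrite -[LHS]/(dunkl_fun y F' k H) /dunkl_fun.
  by rewrite R0 // subr0 FS // raddf0 add0r.
rewrite F'E; split=> [[|k]// H dk|H]; rewrite TE //=; last by rewrite E scalerAl.
  by rewrite FS // scaler0.
exact: ltnW.
Qed.

Definition vacuum : M := fun k H => ((k == 0%N) && (H == 1%:M))%:R.

Lemma grp_vacuum_supp g : supp_le 0 (grp_op g vacuum).
Proof.
move=> [|k] // H _; rewrite -[LHS]/(subst _ (vacuum k.+1 (H *m g))).
by rewrite /vacuum raddf0.
Qed.

Lemma grp_vacuum g H : grp_op g vacuum 0 H = (H *m g == 1%:M)%:R.
Proof. by rewrite -[LHS]/(subst _ (vacuum 0%N (H *m g))) rmorph_nat. Qed.

Lemma symbol_vacuum m sg f g : has_symbol m sg f ->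
  supp_le m (f (grp_op g vacuum)) /\
  forall H, f (grp_op g vacuum) m H = sg H * (H *m g == 1%:M)%:R.
Proof.
move=> fS; have [S E] := fS _ _ (@grp_vacuum_supp g).
by rewrite addn0 in S E; split=> // H; rewrite E grp_vacuum.
Qed.

End DunklRepresentation.

(** * Monomial matrices and the reflections of G(r,1,n) *)

Section MonomialMatrices.
Variables (R : realType) (r n : nat) (xi : R[i]).
Hypothesis xi_prim : r.-primitive_root xi.
Local Notation C := R[i].
Local Notation v_ i := (@basis_vec R n i).
Local Notation alpha_ i := (@dual_vec R n i).
Implicit Types (g h : 'M[C]_n) (i j l : 'I_n) (m t : nat).

Lemma r_gt0 : (0 < r)%N. Proof. exact: prim_order_gt0 xi_prim. Qed.

Lemma xi_neq0 : xi != 0.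
Proof.
apply/eqP => x0; have /eqP := prim_expr_order xi_prim.
by rewrite x0 expr0n eqn0Ngt r_gt0 eq_sym oner_eq0.
Qed.

Lemma xiX_neq0 m : xi ^+ m != 0.
Proof. by rewrite expf_neq0 // xi_neq0. Qed.

Lemma xi_mul_order m : xi ^+ (r * m) = 1.
Proof. by rewrite exprM (prim_expr_order xi_prim) expr1n. Qed.

Lemma xiV m : xi ^- m = xi ^+ (r.-1 * m).
Proof.
apply: (mulfI (xiX_neq0 m)); rewrite divff ?xiX_neq0 // -exprD -mulSn.
by rewrite prednK ?r_gt0 // xi_mul_order.
Qed.

Lemma mx_basis_eq (A B : 'M[C]_n) : (forall l, A *m v_ l = B *m v_ l) -> A = B.
Proof.
move=> AB; apply/matrixP => a l; have := congr1 (fun v : 'cV_n => v a 0) (AB l).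
by rewrite -!colE !mxE.
Qed.

Lemma rv_basis_eq (u u' : 'rV[C]_n) :
  (forall l, (u *m v_ l) 0 0 = (u' *m v_ l) 0 0) -> u = u'.
Proof. by move=> e; apply/rowP => l; have := e l; rewrite -!colE !mxE. Qed.

Lemma dual_basis i l : alpha_ i *m v_ l = (i == l)%:R%:M.
Proof.
rewrite /dual_vec /basis_vec mul_delta_mx_cond; case: eqP => _.
  by apply/matrixP => a b; rewrite !mxE !ord1 !eqxx.
by rewrite mulr0n raddf0.
Qed.

Definition homothety i (z : C) : 'M[C]_n :=
  mx_of_images (fun l => if l == i then z *: v_ i else v_ l).

Lemma homothetyE i z l :
  homothety i z *m v_ l = if l == i then z *: v_ i else v_ l.
Proof. by rewrite mx_of_images_basis. Qed.

Lemma s_mxE i j m l : s_mx xi i j m *m v_ l =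
  if l == j then xi ^+ m *: v_ i else if l == i then xi ^- m *: v_ j else v_ l.
Proof. by rewrite mx_of_images_basis. Qed.

(** With z = xi^t this is the reflection xi_i^t, in the form required above. *)
Lemma homothety_refl i z : homothety i z = 1%:M - ((1 - z) *: v_ i) *m alpha_ i.
Proof.
apply: mx_basis_eq => l; rewrite homothetyE mulmxBl mul1mx -mulmxA dual_basis.
rewrite mul_mx_scalar eq_sym; case: eqP => [->|_]; last by rewrite scale0r subr0.
by rewrite scale1r scalerBl scale1r subKr.
Qed.

Lemma alpha_s_basis i j m l :
  alpha_s xi i j m *m v_ l = (xi ^- m * (l == i)%:R - (l == j)%:R)%:M.
Proof.
rewrite /alpha_s mulmxBl -scalemxAl !dual_basis scale_scalar_mx -raddfB /=.
by rewrite ![_ == l]eq_sym.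
Qed.

Lemma v_s2 i j m : 2 *: v_s xi i j m = xi ^+ m *: v_ i - v_ j.
Proof. by rewrite /v_s scalerA divff ?pnatr_eq0 // scale1r. Qed.

Lemma s_mx_refl i j m : i != j ->
  s_mx xi i j m = 1%:M - (2 *: v_s xi i j m) *m alpha_s xi i j m.
Proof.
move=> ij; apply: mx_basis_eq => l; rewrite s_mxE mulmxBl mul1mx -mulmxA.
rewrite v_s2 alpha_s_basis mul_mx_scalar.
have [->|lj] := eqVneq l j.
  by rewrite eq_sym (negPf ij) mulr0 sub0r scaleN1r opprK addrC subrK.
have [->|li] := eqVneq l i; last by rewrite mulr0 subrr scale0r subr0.
by rewrite mulr1 subr0 scalerBr scalerA mulVf ?xiX_neq0 // scale1r subKr.
Qed.

Lemma s_mx_eq i j m m' : xi ^+ m = xi ^+ m' -> s_mx xi i j m = s_mx xi i j m'.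
Proof. by rewrite /s_mx => ->. Qed.

(** The elements of G permute the coordinate lines; sg is the permutation and the
    exponents a record the roots of unity. *)
Definition monomial_by (sg : {perm 'I_n}) (a : 'I_n -> nat) g :=
  forall l, g *m v_ l = xi ^+ a l *: v_ (sg l).

Lemma monomial_unit sg a g : monomial_by sg a g -> g \in unitmx.
Proof.
move=> gE; pose f l := xi ^- a (sg^-1%g l) *: v_ (sg^-1%g l).
suff /mulmx1_unit[] : g *m mx_of_images f = 1%:M by [].
apply: mx_basis_eq => l; rewrite -mulmxA mx_of_images_basis mul1mx -scalemxAr gE.
by rewrite scalerA mulVf ?xiX_neq0 // scale1r permKV.
Qed.

Lemma monomial1 : monomial_by 1%g (fun=> 0%N) 1%:M.
Proof. by move=> l; rewrite mul1mx expr0 scale1r perm1. Qed.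

Lemma monomialM sg a g sg' a' h : monomial_by sg a g -> monomial_by sg' a' h ->
  monomial_by (sg' * sg)%g (fun l => (a' l + a (sg' l))%N) (g *m h).
Proof.
by move=> gE hE l; rewrite -mulmxA hE -scalemxAr gE scalerA exprD permM.
Qed.

Lemma monomialV sg a g : monomial_by sg a g ->
  monomial_by sg^-1%g (fun l => (r.-1 * a (sg^-1%g l))%N) (invmx g).
Proof.
move=> gE l; apply: (can_inj (mulKmx (monomial_unit gE))).
rewrite mulKVmx ?(monomial_unit gE) // -scalemxAr gE -xiV scalerA.
by rewrite mulVf ?xiX_neq0 // scale1r permKV.
Qed.

Lemma monomial_homothety i m :
  monomial_by 1%g (fun l => if l == i then m else 0%N) (homothety i (xi ^+ m)).
Proof.
by move=> l; rewrite homothetyE perm1; case: eqP => [->|] //; rewrite scale1r.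
Qed.

Lemma monomial_s i j m : monomial_by (tperm i j)
  (fun l => if l == j then m else if l == i then (r.-1 * m)%N else 0%N)
  (s_mx xi i j m).
Proof.
move=> l; rewrite s_mxE; have [->|lj] := eqVneq l j; first by rewrite tpermR.
have [->|li] := eqVneq l i; first by rewrite tpermL -xiV.
by rewrite scale1r tpermD // eq_sym.
Qed.

Lemma G_monomial g : in_gengroup (G_gen xi) g -> exists sg a, monomial_by sg a g.
Proof.
elim=> {g} [g [i|i j m _]||g h _ [sg [a gE]] _ [sg' [a' hE]]|g _ [sg [a gE]]].
- exists 1%g, (fun l => if l == i then 1%N else 0%N).
  exact: (@monomial_homothety i 1).
- by do 2!eexists; apply: monomial_s.
- by do 2!eexists; apply: monomial1.
- by do 2!eexists; apply: monomialM gE hE.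
- by do 2!eexists; apply: monomialV gE.
Qed.

Lemma homothety_conj sg a g i z : monomial_by sg a g ->
  homothety (sg i) z *m g = g *m homothety i z.
Proof.
move=> gE; apply: mx_basis_eq => l; rewrite -!mulmxA gE homothetyE -scalemxAr.
rewrite homothetyE (inj_eq perm_inj); case: eqP => [->|_]; last by rewrite gE.
by rewrite -scalemxAr gE !scalerA mulrC.
Qed.

(** The exponent of the conjugate is m + a_i - a_j modulo r; r.-1 * a_j stands for
    - a_j. *)
Lemma s_mx_conj sg a g i j m : monomial_by sg a g ->
  s_mx xi (sg i) (sg j) (m + a i + r.-1 * a j) *m g = g *m s_mx xi i j m.
Proof.
move=> gE; apply: mx_basis_eq => l; rewrite -!mulmxA gE s_mxE -scalemxAr.
rewrite s_mxE !(inj_eq perm_inj).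
have E : xi ^+ (m + a i + r.-1 * a j) = xi ^+ m * xi ^+ a i * xi ^- a j.
  by rewrite !exprD -xiV.
have [->|lj] := eqVneq l j.
  rewrite -scalemxAr gE !scalerA E; congr (_ *: _).
  by rewrite mulrC divfK ?xiX_neq0.
have [->|li] := eqVneq l i; last by rewrite gE.
rewrite -scalemxAr gE !scalerA E; congr (_ *: _).
by field; rewrite !xiX_neq0.
Qed.

Lemma dual_conj sg a g i : monomial_by sg a g ->
  alpha_ (sg i) *m g = xi ^+ a i *: alpha_ i.
Proof.
move=> gE; apply: rv_basis_eq => l; rewrite -mulmxA gE -scalemxAl -scalemxAr.
rewrite !dual_basis (inj_eq perm_inj) !scale_scalar_mx.
by case: eqP => [->|_] //; rewrite !mulr0.
Qed.

Lemma alpha_s_conj sg a g i j m : monomial_by sg a g ->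
  alpha_s xi (sg i) (sg j) (m + a i + r.-1 * a j) *m g
  = xi ^+ a j *: alpha_s xi i j m.
Proof.
move=> gE; rewrite /alpha_s mulmxBl -scalemxAl !(dual_conj _ gE) scalerBr !scalerA.
congr (_ *: _ - _); rewrite !exprD -xiV; field; by rewrite !xiX_neq0.
Qed.

End MonomialMatrices.

(** * The symplectic reflection algebra acts by Dunkl operators *)

Section CherednikRepresentation.
Variables (R : realType) (r n : nat) (xi : R[i]).
Hypothesis xi_prim : r.-primitive_root xi.
Variable k : multiplicity r n xi.
Local Notation C := R[i].
Local Notation v_ i := (@basis_vec R n i).
Local Notation alpha_ i := (@dual_vec R n i).
Local Notation G := (G n xi).

(** Pairs (t, i) for the reflections xi_i^t and triples (m, (i, j)) for the
    s_ij^[m]; the latter are counted twice, as s_ij^[m] = s_ji^[-m], exactly as in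
    the defining relation. *)
Definition refl_index : finType := ('I_r * 'I_n + 'I_r * ('I_n * 'I_n))%type.
Implicit Type j : refl_index.

Definition refl_ok : pred refl_index := fun j =>
  match j with inl p => (0 < p.1)%N | inr p => p.2.1 != p.2.2 end.
(** The vector w of a divided difference is (1 - xi^-t) v_i, respectively twice
    v_ij^[m], where the defining relation has v_i and v_ij^[m]: the multiplicities
    compensate for these factors. *)
Definition refl_c j : C :=
  match j with
  | inl p => mult_t k p.1 / (1 - xi ^- p.1)
  | inr p => mult_0 k / 2
  end.
Definition refl_mx j : 'M[C]_n :=
  match j with
  | inl p => homothety p.2 (xi ^+ p.1)
  | inr p => s_mx xi p.2.1 p.2.2 p.1
  end.
Definition refl_form j : 'rV[C]_n :=
  match j with
  | inl p => alpha_ p.2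
  | inr p => alpha_s xi p.2.1 p.2.2 p.1
  end.
Definition refl_vec j : 'cV[C]_n :=
  match j with
  | inl p => (1 - xi ^+ p.1) *: v_ p.2
  | inr p => 2 *: v_s xi p.2.1 p.2.2 p.1
  end.
Definition refl_vecV j : 'cV[C]_n :=
  match j with
  | inl p => (1 - xi ^- p.1) *: v_ p.2
  | inr p => 2 *: v_s xi p.2.1 p.2.2 p.1
  end.

Lemma refl_form_neq0 j : refl_ok j -> refl_form j != 0.
Proof.
case: j => [[t i]|[m [i j]]] /= ok; apply/eqP => al0.
  have := dual_basis R i i; rewrite al0 mul0mx eqxx => /matrixP/(_ 0 0)/eqP.
  by rewrite !mxE eqxx eq_sym oner_eq0.
have := alpha_s_basis xi i j m j; rewrite al0 mul0mx eq_sym (negPf ok) eqxx.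
move=> /matrixP/(_ 0 0)/eqP.
by rewrite !mxE eqxx mulr0 sub0r eq_sym oppr_eq0 oner_eq0.
Qed.

Lemma refl_mxE j : refl_ok j -> refl_mx j = 1%:M - refl_vec j *m refl_form j.
Proof.
case: j => [[t i]|[m [i j]]] /= ok; first exact: homothety_refl.
exact: (s_mx_refl xi_prim).
Qed.

Lemma refl_mxK j : refl_ok j ->
  refl_mx j *m (1%:M - refl_vecV j *m refl_form j) = 1%:M.
Proof.
move=> ok; rewrite refl_mxE // mulmxBr mulmx1 mulmxBl mul1mx -!mulmxA.
suff e : refl_vec j *m (refl_form j *m refl_vecV j) = refl_vec j + refl_vecV j.
  by rewrite [refl_form j *m (_ *m _)]mulmxA mulmxA e mulmxDl opprB addrK subrK.
case: j ok => [[t i]|[m [i j]]] /= ok.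
  rewrite -scalemxAr dual_basis eqxx scale_scalar_mx mulr1 mul_mx_scalar -scalerDl.
  by rewrite scalerA; congr (_ *: _); field; rewrite (xiX_neq0 xi_prim).
rewrite v_s2 mulmxBr -scalemxAr !alpha_s_basis !eqxx [j == i]eq_sym (negPf ok).
rewrite scale_scalar_mx -raddfB /= mul_mx_scalar -[RHS]mulr2n -[RHS]scaler_nat.
by congr (_ *: _); field; rewrite (xiX_neq0 xi_prim).
Qed.

Lemma xi_neq1 t : (0 < t < r)%N -> 1 - xi ^- t != 0.
Proof.
move=> /andP[t0 tr]; rewrite subr_eq0 eq_sym invr_eq1.
by rewrite -(prim_order_dvd xi_prim) gtnNdvd.
Qed.

(** An element of G with permutation sg and exponents a sends (t, i) to
    (t, sg i), and (m, (i, j)) to (m + a_i - a_j, (sg i, sg j)) with the first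
    entry modulo r. *)
Lemma refl_invariantG (g : 'M[C]_n) : in_gengroup (G_gen xi) g ->
  refl_invariant refl_ok refl_c refl_mx refl_form g.
Proof.
move=> /(G_monomial xi_prim)[sg [a gE]].
have r0 := r_gt0 xi_prim.
pose p j : refl_index :=
  match j with
  | inl q => inl (q.1, sg q.2)
  | inr q => inr (Ordinal (ltn_pmod (q.1 + a q.2.1 + r.-1 * a q.2.2) r0),
                  (sg q.2.1, sg q.2.2))
  end.
exists p, (fun j => match j with inl q => xi ^+ a q.2 | inr q => xi ^+ a q.2.2 end).
split.
- move=> [[t i]|[m [i j]]] [[t' i']|[m' [i' j']]] //= [].
    by move=> -> /perm_inj ->.
  move=> e /perm_inj ei /perm_inj ej; rewrite ei ej in e *; congr (inr (_, _)).
  apply: val_inj; move/eqP: e; rewrite -!addnA eqn_modDr => /eqP.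
  by rewrite !modn_small.
- by move=> [[t i]|[m [i j]]] //=; rewrite (inj_eq perm_inj).
- by move=> [[t i]|[m [i j]]].
move=> [[t i]|[m [i j]]] /= ok; rewrite (xiX_neq0 xi_prim); split=> //.
- exact: dual_conj gE.
- exact: homothety_conj gE.
- rewrite -(alpha_s_conj xi_prim i j m gE) /alpha_s (prim_expr_mod xi_prim) //.
- rewrite -(s_mx_conj xi_prim i j m gE); congr (_ *m _).
  by apply: s_mx_eq; rewrite (prim_expr_mod xi_prim).
Qed.

Lemma xi_mx_homothety i t :
  homothety i (xi ^+ t.+1) = xi_mx xi i *m homothety i (xi ^+ t) :> 'M[C]_n.
Proof.
rewrite -[xi_mx xi i]/(homothety i xi); apply: mx_basis_eq => l.
rewrite -mulmxA !homothetyE; case: eqP => [_|/eqP/negPf li].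
  by rewrite -scalemxAr homothetyE eqxx scalerA exprSr.
by rewrite homothetyE li.
Qed.

Lemma xi_powE i t : (xi_ xi i ^+ t)%g = homothety i (xi ^+ t) :> 'M[C]_n.
Proof.
elim: t => [|t IHt].
  by rewrite homothety_refl expr0 subrr scale0r mul0mx subr0.
by rewrite expgS /= IHt xi_mx_homothety.
Qed.

Lemma refl_mxG j : in_gengroup (G_gen xi) (refl_mx j).
Proof.
case: j => [[t i]|[m [i j]]] /=; last exact: s_mx_in.
by rewrite -xi_powE; exact: gengroupP.
Qed.

Lemma G_unit (g : 'M[C]_n) : in_gengroup (G_gen xi) g -> g \in unitmx.
Proof. by move=> /(G_monomial xi_prim)[sg [a /(monomial_unit xi_prim)]]. Qed.

Local Notation M := (dunkl_space C n).
Local Notation lam := (const_mx 1 : 'rV[C]_n).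
Local Notation mul_op := (@mul_op C n).
Local Notation grp_op := (@grp_op C n).
Local Notation dunkl_op := (dunkl_op refl_c refl_mx refl_vecV lam refl_form_neq0).

Lemma sum_refl_index (V : nmodType) (F1 : nat -> 'I_n -> V)
    (F2 : nat -> 'I_n -> 'I_n -> V) :
  \sum_(j | refl_ok j) match j with
                       | inl p => F1 p.1 p.2
                       | inr p => F2 p.1 p.2.1 p.2.2
                       end
  = \sum_(1 <= t < r) \sum_(i < n) F1 t i
    + \sum_(m < r) \sum_(i < n) \sum_(j < n | i != j) F2 m i j.
Proof.
rewrite big_sumType /= big_geq_mkord pair_big_dep /=; congr (_ + _).
  by apply: eq_bigl => p; rewrite andbT.
have E (m : 'I_r) : true -> \sum_(i < n) \sum_(j < n | i != j) F2 m i j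
    = \sum_(p : 'I_n * 'I_n | p.1 != p.2) F2 m p.1 p.2.
  by move=> _; rewrite pair_big_dep.
by rewrite (eq_bigr _ E) pair_big_dep.
Qed.

Lemma dunkl_commE u y : dunkl_comm refl_ok refl_c refl_mx refl_form refl_vecV u y =
  \sum_(1 <= t < r) endo_scalar M (mult_t k t) * (\sum_(i < n)
     endo_scalar M (pairing y (alpha_ i) * pairing (v_ i) u)
       * grp_op (xi_ xi i ^+ t)%g)
  + endo_scalar M (mult_0 k) * (\sum_(m < r) \sum_(i < n) \sum_(j < n | i != j)
     endo_scalar M (pairing y (alpha_s xi i j m) * pairing (v_s xi i j m) u)
       * grp_op (s_ xi i j m)).
Proof.
pose F1 (t : nat) (i : 'I_n) := endo_scalar M (mult_t k t) *
  (endo_scalar M (pairing y (alpha_ i) * pairing (v_ i) u)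
       * grp_op (xi_ xi i ^+ t)%g).
pose F2 (m : nat) (i j : 'I_n) := endo_scalar M (mult_0 k) *
  (endo_scalar M (pairing y (alpha_s xi i j m) * pairing (v_s xi i j m) u)
       * grp_op (s_ xi i j m)).
transitivity (\sum_(j | refl_ok j) match j with
  | inl p => F1 p.1 p.2 | inr p => F2 p.1 p.2.1 p.2.2 end).
  apply: eq_bigr => -[[t i]|[m [i j]]] /= ok; rewrite /F1 /F2 mulrA -rmorphM.
    rewrite xi_powE; congr (endo_scalar _ _ * _).
    rewrite /pairing -scalemxAr [in X in _ * X = _]mxE.
    have : 1 - xi ^- t != 0 by apply: xi_neq1; rewrite ok ltn_ord.
    by move: (1 - _) (_ 0 0) (_ 0 0) => d z z' d0; field.
  congr (endo_scalar _ _ * _).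
  rewrite /pairing -scalemxAr [in X in _ * X = _]mxE.
  by move: (_ 0 0) (_ 0 0) => z z'; field.
rewrite sum_refl_index; congr (_ + _).
  by apply: eq_bigr => t _; rewrite mulr_sumr.
rewrite mulr_sumr; apply: eq_bigr => m _; rewrite mulr_sumr.
by apply: eq_bigr => i _; rewrite mulr_sumr.
Qed.

(** The form lam is the one with all coordinates equal to 1: its images under G
    have nonzero coordinates, which makes the symbols of the D_i nonzero. *)
Lemma H_alg_representation :
  exists rho : {rmorphism H_alg k -> endo M},
    [/\ forall c a, rho (c *: a) = endo_scalar M c * rho a,
       forall x, rho (H_x k x) = mul_op x,
       forall y, rho (H_y k y) = dunkl_op y
     & forall g : G, rho (H_g k g) = grp_op g].
Proof.
pose f (a : H_index n xi) : endo M :=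
  match a with
  | inl (inl x) => mul_op x
  | inl (inr y) => dunkl_op y
  | inr g => grp_op g
  end.
have [|rho [rhoZ rhoE]] := @pres_alg_universal C (H_index n xi) (endo M)
  (endo_scalar M) f (@endo_scalarC _ _) (@H_rel R r n xi k).
  move=> phi phiZ phiE.
  have phiX x : phi (H_free_x xi x) = mul_op x by exact: (phiE (inl (inl x))).
  have phiY y : phi (H_free_y xi y) = dunkl_op y by exact: (phiE (inl (inr y))).
  have phiT g : phi (H_free_g g) = grp_op g by exact: (phiE (inr g)).
  have phiM a b : phi (a * b) = phi a * phi b by exact: rmorphM.
  have phiD a b : phi (a + b) = phi a + phi b by exact: rmorphD.
  have phiB a b : phi (a - b) = phi a - phi b by exact: rmorphB.
  have phi0 : phi 0 = 0 by exact: rmorph0.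
  have phi1 : phi 1 = 1 by exact: rmorph1.
  have gU (g : G) : (g : 'M[C]_n) \in unitmx by exact/G_unit/gengroupP.
  have gV (g : G) : grp_op g * grp_op (g^-1)%g = 1.
    rewrite -grp_opM ?gU // ?mulmxV ?gU ?grp_op1 //.
  have sinv j : refl_ok j -> refl_invariant refl_ok refl_c refl_mx refl_form (refl_mx j).
    by move=> _; apply/refl_invariantG/refl_mxG.
  move=> a b; case=> {a b}.
  - move=> a x1 x2; rewrite [RHS]phiD [X in _ = X + _]phiZ !phiX; exact: mul_opP.
  - move=> a y1 y2; rewrite [RHS]phiD [X in _ = X + _]phiZ !phiY; exact: dunkl_opP.
  - by rewrite [RHS]phi1 phiT; exact: grp_op1.
  - by move=> g h; rewrite [RHS]phiM !phiT grp_opM ?gU.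
  - move=> g x; rewrite [LHS]phiM [X in X * _]phiM (phiT g^-1%g) (phiT g) !phiX.
    by rewrite grp_mul_op -mulrA gV mulr1.
  - move=> g y; rewrite [LHS]phiM [X in X * _]phiM (phiT g^-1%g) (phiT g) !phiY.
    rewrite (grp_dunkl_op _ refl_form_neq0 refl_mxK) ?gU //; last first.
      exact/refl_invariantG/gengroupP.
    by rewrite -mulrA gV mulr1.
  - move=> x1 x2; rewrite [LHS]phiB [X in X - _]phiM [X in _ - X]phiM [RHS]phi0.
    by rewrite (phiX x1) (phiX x2) [X in X - _]mul_mul_op subrr.
  - move=> y1 y2; rewrite [LHS]phiB [X in X - _]phiM [X in _ - X]phiM [RHS]phi0.
    rewrite (phiY y1) (phiY y2).
    by rewrite [X in X - _](dunkl_opC _ refl_form_neq0 refl_mxE refl_mxK sinv) subrr.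
  move=> y x; rewrite [LHS]phiB [X in X - _ = _]phiM [X in _ - X = _]phiM.
  rewrite (phiX x) (phiY y) (dunkl_mul_op _ _ refl_form_neq0 refl_mxK).
  rewrite dunkl_commE opprD addrA [RHS]phiB [X in _ = X - _]phiB.
  rewrite [X in _ = X - _ - _]phiZ phi1 mulr1; congr (_ - _ - _).
    rewrite [RHS](big_morph phi phiD phi0); apply: eq_bigr => t _.
    rewrite [RHS]phiZ; congr (_ * _); rewrite [RHS](big_morph phi phiD phi0).
    by apply: eq_bigr => i _; rewrite [RHS]phiZ phiT.
  rewrite [RHS]phiZ; congr (_ * _).
  rewrite [RHS](big_morph phi phiD phi0); apply: eq_bigr => m _.
  rewrite [RHS](big_morph phi phiD phi0); apply: eq_bigr => i _.
  rewrite [RHS](big_morph phi phiD phi0); apply: eq_bigr => j _.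
  by rewrite [RHS]phiZ phiT.
exists rho; split=> [|x|y|g] //.
- exact: (rhoE (inl (inl x))).
- exact: (rhoE (inl (inr y))).
exact: (rhoE (inr g)).
Qed.

End CherednikRepresentation.

(** * Linear independence of ordered monomials *)

Section Independence.
Variables (C : fieldType) (n : nat) (T : eqType) (gm : T -> 'M[C]_n).
Variables (f : 'I_n -> endo (dunkl_space C n)) (a : 'I_n -> 'M[C]_n -> C).
Hypothesis gm_inj : injective gm.
Hypothesis gm_unit : forall g, gm g \in unitmx.
Hypothesis f_symbol : forall i, has_symbol 1 (fun H => a i H *: 'X_i) (f i).
Hypothesis a_neq0 : forall i g, a i (invmx (gm g)) != 0.

Lemma symbol_mon (m : 'X_{1..n}) :
  has_symbol (mdeg m) (fun H => (\prod_(i < n) a i H ^+ m i) *: 'X_[m])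
    (\prod_(i < n) f i ^+ m i).
Proof.
have E H : (\prod_(i < n) a i H ^+ m i) *: 'X_[m]
    = \prod_(i < n) (a i H *: 'X_i : mpoly n C) ^+ m i.
  under [RHS]eq_bigr do rewrite exprZn.
  by rewrite scaler_prod -mpolyXE_id.
have -> : (fun H => (\prod_(i < n) a i H ^+ m i) *: 'X_[m])
   = (fun H => \prod_(i < n) (a i H *: 'X_i : mpoly n C) ^+ m i) by exact/funext.
rewrite mdegE.
have symbolX i k : has_symbol k (fun H => (a i H *: 'X_i : mpoly n C) ^+ k) (f i ^+ k).
  elim: k => [|k IHk]; first exact: symbol1.
  have -> : (fun H => (a i H *: 'X_i : mpoly n C) ^+ k.+1)
    = (fun H => (a i H *: 'X_i) * (a i H *: 'X_i) ^+ k).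
    by apply/funext => H; rewrite exprS.
  by rewrite exprS -add1n; apply: symbolM.
elim: (index_enum _) => [|i s IHs].
  rewrite !big_nil; have -> : (fun H => \prod_(i <- [::]) (a i H *: 'X_i : mpoly n C) ^+ m i)
    = fun=> 1 by apply/funext => H; rewrite big_nil.
  exact: symbol1.
rewrite !big_cons.
have -> : (fun H => \prod_(j <- i :: s) (a j H *: 'X_j : mpoly n C) ^+ m j)
    = (fun H => (a i H *: 'X_i) ^+ m i * \prod_(j <- s) (a j H *: 'X_j) ^+ m j).
  by apply/funext => H; rewrite big_cons.
exact: symbolM.
Qed.

(** Among the terms with nonzero coefficient choose one of maximal degree, with
    group element g0, and evaluate at the corresponding level and at the matrix
    g0^-1: the terms of lower degree do not reach this level, those with another
    group element vanish at this matrix, and the others are multiples of distinct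
    monomials. *)
Lemma pbw_independent (U : seq ('X_{1..n} * T)) (c : 'X_{1..n} * T -> C) :
  uniq U -> (forall q, q \in U -> c q != 0) ->
  \sum_(q <- U) endo_scalar (dunkl_space C n) (c q)
      * ((\prod_(i < n) f i ^+ q.1 i) * grp_op (gm q.2)) = 0 ->
  U = [::].
Proof.
move=> uU c0 E; apply/eqP; apply: contraT => U0; exfalso.
have [q0 q0U q0max] : exists2 q0, q0 \in U & forall q, q \in U -> (mdeg q.1 <= mdeg q0.1)%N.
  elim: U U0 {uU c0 E} => // q U IHU _; have [->|/IHU[q0 q0U q0max]] := eqVneq U [::].
    by exists q; rewrite ?mem_head // => q'; rewrite inE => /eqP->.
  have [le|lt] := leqP (mdeg q.1) (mdeg q0.1).
    exists q0; first by rewrite inE q0U orbT.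
    by move=> q'; rewrite inE => /orP[/eqP->|/q0max].
  exists q; rewrite ?mem_head // => q'; rewrite inE => /orP[/eqP->//|/q0max le].
  exact/ltnW/(leq_ltn_trans le).
pose H := invmx (gm q0.2).
pose v (q : 'X_{1..n} * T) := (\prod_(i < n) f i ^+ q.1 i)
  (grp_op (gm q.2) (@vacuum C n)) (mdeg q0.1) H.
have vE q : q \in U -> mcoeff q0.1 (v q)
    = (\prod_(i < n) a i H ^+ q0.1 i) *+ (q == q0).
  move=> qU; have [S val] := symbol_vacuum (gm q.2) (symbol_mon q.1).
  have [dq|dq] := ltnP (mdeg q.1) (mdeg q0.1).
    rewrite /v S // mcoeff0; case: eqP => // e.
    by rewrite e ltnn in dq.
  have {}dq : mdeg q.1 = mdeg q0.1 by apply/eqP; rewrite eqn_leq dq q0max.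
  rewrite /v -dq val.
  have [g_eq|g_neq] := eqVneq q.2 q0.2.
    rewrite g_eq mulVmx // eqxx mulr1 mcoeffZ mcoeffX.
    have -> : (q == q0) = (q.1 == q0.1) by rewrite -pair_eqE /pair_eq g_eq eqxx andbT.
    by case: (q.1 =P q0.1) => [->|_]; rewrite ?mulr1 ?mulr0 ?mulr1n ?mulr0n.
  have /negPf-> : H *m gm q.2 != 1%:M.
    apply: contra g_neq => /eqP He; apply/eqP/gm_inj.
    by rewrite -[gm q.2](mulKVmx (gm_unit q0.2)) He mulmx1.
  rewrite mulr0 mcoeff0; case: eqP => // e; by rewrite e eqxx in g_neq.
have := congr1 (fun F : endo (dunkl_space C n) => F (@vacuum C n) (mdeg q0.1) H) E.
rewrite endo_sum dunkl_space_sum => {}E.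
have {E} : \sum_(q <- U) c q *: v q = 0 by exact: E.
move=> /(congr1 (mcoeff q0.1)); rewrite linear_sum mcoeff0.
rewrite (bigD1_seq q0) // big1_seq ?addr0 => [|q /andP[qq0 qU]]; last first.
  by rewrite linearZ /= vE // (negPf qq0) mulr0.
rewrite linearZ /= vE // eqxx mulr1n addr0.
move/eqP; apply/negP; apply: mulf_neq0; first exact: c0.
apply/prodf_neq0 => i _.
by rewrite expf_neq0 ?a_neq0.
Qed.

End Independence.

(** * Ordered monomials span the graded Hecke algebra *)

Section AbstractHecke.
Variables (R : realType) (r n : nat) (xi : R[i]).
Hypothesis xi_prim : r.-primitive_root xi.
Local Notation C := R[i].
Local Notation v_ i := (@basis_vec R n i).
Local Notation G0 := (G0 n xi).
Variables (B : pzRingType) (iota : {rmorphism C -> B}).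
Hypothesis iotaC : forall c a, iota c * a = a * iota c.
Variables (e : 'I_n -> B) (t : G0 -> B) (c0 : C).
Implicit Types (g h : G0) (i j l : 'I_n).
(** The element c~_ij, computed in the ring B. *)
Definition c_tilde_in (i j : 'I_n) : B := iota (c0 / 2) * \sum_(m < r)
  (t (theta_ xi i ^+ m * theta_ xi j ^- m)%g + t (theta_ xi i ^- m * theta_ xi j ^+ m)%g).
Hypothesis ee : forall i j, e i * e j = e j * e i.
Hypothesis t1 : t 1%g = 1.
Hypothesis tM : forall g h, t g * t h = t (g * h)%g.
Hypothesis t_theta : forall i j, t (theta_ xi i) * e j = e j * t (theta_ xi i).
Hypothesis t_far : forall j j' i : 'I_n, j' = j.+1 :> nat -> i != j -> i != j' ->
  t (transp_ xi j j') * e i = e i * t (transp_ xi j j').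
Hypothesis t_near : forall i i' : 'I_n, i' = i.+1 :> nat ->
  t (transp_ xi i i') * e i = e i' * t (transp_ xi i i') - c_tilde_in i i'.

Lemma transp_s i j : transp_mx R i j = s_mx xi i j 0.
Proof.
rewrite /s_mx /transp_mx; congr mx_of_images; apply/funext => l.
rewrite expr0 invr1 !scale1r; case: tpermP => [->|->|/eqP/negPf-> /eqP/negPf->] //.
- by case: eqP => [->|]; rewrite ?eqxx.
- by rewrite eqxx.
Qed.

Lemma G0_sub_G (g : 'M[C]_n) : in_gengroup (G0_gen xi) g -> in_gengroup (G_gen xi) g.
Proof.
elim=> {g} [g [i j _|i]||g h _ Ig _ Ih|g _ Ig].
- by rewrite transp_s; exact: s_mx_in.
- exact: xi_mx_in.
- exact: in_gengroup1.
- exact: in_gengroupM.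
exact: in_gengroupV.
Qed.

Lemma G0_mulVg g : (g^-1 * g)%g = 1%g.
Proof.
by apply: val_inj; rewrite /= mulVmx // (G_unit xi_prim (G0_sub_G (gengroupP g))).
Qed.

Lemma G0_mulgV g : (g * g^-1)%g = 1%g.
Proof.
by apply: val_inj; rewrite /= mulmxV // (G_unit xi_prim (G0_sub_G (gengroupP g))).
Qed.

Lemma t_Vg g : t g^-1%g * t g = 1. Proof. by rewrite tM G0_mulVg t1. Qed.
Lemma t_gV g : t g * t g^-1%g = 1. Proof. by rewrite tM G0_mulgV t1. Qed.

Definition grp_comb (b : B) := exists L : seq (C * G0),
  b = \sum_(q <- L) iota q.1 * t q.2.

Lemma grp_comb0 : grp_comb 0.
Proof. by exists [::]; rewrite big_nil. Qed.

Lemma grp_combD b b' : grp_comb b -> grp_comb b' -> grp_comb (b + b').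
Proof. by move=> [L ->] [L' ->]; exists (L ++ L'); rewrite big_cat. Qed.

Lemma grp_comb_sum (I : Type) (s : seq I) (P : pred I) (F : I -> B) :
  (forall x, P x -> grp_comb (F x)) -> grp_comb (\sum_(x <- s | P x) F x).
Proof.
move=> FP; elim/big_rec: _ => [|x b Px]; first exact: grp_comb0.
by apply: grp_combD; apply: FP.
Qed.

Lemma grp_combZ c b : grp_comb b -> grp_comb (iota c * b).
Proof.
move=> [L ->]; exists [seq (c * q.1, q.2) | q <- L]; rewrite big_map mulr_sumr.
by apply: eq_bigr => q _; rewrite /= rmorphM mulrA.
Qed.

Lemma grp_combN b : grp_comb b -> grp_comb (- b).
Proof. by rewrite -mulN1r -(rmorph1 iota) -rmorphN; apply: grp_combZ. Qed.

Lemma grp_combMl g b : grp_comb b -> grp_comb (t g * b).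
Proof.
move=> [L ->]; exists [seq (q.1, g * q.2)%g | q <- L]; rewrite big_map mulr_sumr.
by apply: eq_bigr => q _; rewrite /= mulrA -iotaC -mulrA tM.
Qed.

Lemma grp_combMr g b : grp_comb b -> grp_comb (b * t g).
Proof.
move=> [L ->]; exists [seq (q.1, q.2 * g)%g | q <- L]; rewrite big_map mulr_suml.
by apply: eq_bigr => q _; rewrite /= -mulrA tM.
Qed.

Lemma grp_comb_t g : grp_comb (t g).
Proof. by exists [:: (1, g)]; rewrite big_seq1 rmorph1 mul1r. Qed.

Lemma grp_comb_c_tilde i j : grp_comb (c_tilde_in i j).
Proof.
apply/grp_combZ/grp_comb_sum => m _.
by apply: grp_combD; apply: grp_comb_t.
Qed.

(** The commutation rule modulo the span of the group.  Unlike the defining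
    relations, it is stable under products and inverses in the group. *)
Definition straightens g := exists sg : {perm 'I_n},
  forall i, grp_comb (t g * e i - e (sg i) * t g).

Lemma straightens1 : straightens 1%g.
Proof. by exists 1%g => i; rewrite perm1 t1 mulr1 mul1r subrr; exact: grp_comb0. Qed.

Lemma straightensM g h : straightens g -> straightens h -> straightens (g * h)%g.
Proof.
move=> [sg gE] [sh hE]; exists (sh * sg)%g => i; rewrite permM -tM.
have -> : t g * t h * e i - e (sg (sh i)) * (t g * t h)
  = t g * (t h * e i - e (sh i) * t h) + (t g * e (sh i) - e (sg (sh i)) * t g) * t h.
  by rewrite mulrBr mulrBl !mulrA subrKA.
by apply: grp_combD; [apply: grp_combMl|apply: grp_combMr].
Qed.

(** Multiply the rule for g by t_(g^-1) on both sides, at the index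
    sg^-1 i. *)
Lemma straightensV g : straightens g -> straightens g^-1%g.
Proof.
move=> [sg gE]; exists sg^-1%g => i.
have -> : t g^-1%g * e i - e (sg^-1%g i) * t g^-1%g
  = - (t g^-1%g * (t g * e (sg^-1%g i) - e (sg (sg^-1%g i)) * t g) * t g^-1%g).
  rewrite permKV mulrBr mulrBl mulrA t_Vg mul1r opprB mulrA -[_ * t g * _]mulrA.
  by rewrite t_gV mulr1.
by apply: grp_combN; apply: grp_combMr; apply: grp_combMl.
Qed.

Lemma straightens_theta i : straightens (theta_ xi i).
Proof. by exists 1%g => j; rewrite perm1 t_theta subrr; exact: grp_comb0. Qed.

Lemma transp_conj i j l : i != j -> i != l ->
  (transp_ xi j l * transp_ xi i j * transp_ xi j l)%g = transp_ xi i l.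
Proof.
move=> ij il; apply: val_inj; apply: mx_basis_eq => a /=.
rewrite -!mulmxA !mx_of_images_basis; congr basis_vec.
have := tpermJ i j (tperm j l); rewrite conjgE tpermV => e1.
have := congr1 (fun s : {perm 'I_n} => s a) e1.
by rewrite !permM tpermL tpermD // eq_sym.
Qed.

Lemma transp_sq i j : (transp_ xi i j * transp_ xi i j)%g = 1%g.
Proof.
apply: val_inj; apply: mx_basis_eq => a /=.
by rewrite -mulmxA !mx_of_images_basis tpermK mul1mx.
Qed.

Lemma transpC i j : transp_ xi i j = transp_ xi j i.
Proof. by apply: val_inj; rewrite /= /transp_mx tpermC. Qed.

(** The defining relation moves t across e_i to e_(i+1); multiplied by t on both
    sides it also moves t across e_(i+1), as t is an involution. *)
Lemma straightens_adj i j : j = i.+1 :> nat -> straightens (transp_ xi i j).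
Proof.
move=> ji; exists (tperm i j) => l.
have near : grp_comb (t (transp_ xi i j) * e i - e j * t (transp_ xi i j)).
  by rewrite (t_near ji) addrC addKr; apply/grp_combN/grp_comb_c_tilde.
case: tpermP => [->|->|/eqP li /eqP lj] //; last first.
  by rewrite (t_far ji) // subrr; exact: grp_comb0.
have tt : t (transp_ xi i j) * t (transp_ xi i j) = 1 by rewrite tM transp_sq t1.
have -> : t (transp_ xi i j) * e j - e i * t (transp_ xi i j)
  = - (t (transp_ xi i j) * (t (transp_ xi i j) * e i - e j * t (transp_ xi i j))
       * t (transp_ xi i j)).
  by rewrite mulrBr mulrBl !mulrA tt mul1r opprB -[_ * _ * _ * _]mulrA tt mulr1.
by apply: grp_combN; apply: grp_combMr; apply: grp_combMl.
Qed.

(** By induction on the distance of i and j, every transposition being a conjugate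
    of a shorter one by an adjacent one. *)
Lemma straightens_transp i j : straightens (transp_ xi i j).
Proof.
wlog ij : i j / (i <= j)%N.
  by move=> W; case/orP: (leq_total i j) => ij; [exact: W|rewrite transpC; exact: W].
move: {2}(j - i)%N (erefl (j - i)%N) => d; elim: d j ij => [|d IHd] j ij dE.
  have -> : j = i by apply: val_inj; apply/eqP; rewrite eqn_leq ij -subn_eq0 dE.
  have -> : transp_ xi i i = 1%g.
    apply: val_inj; apply: mx_basis_eq => a.
    by rewrite /= mx_of_images_basis tperm1 perm1 mul1mx.
  exact: straightens1.
have jl : (j.-1 < n)%N by apply: leq_ltn_trans (leq_pred _) (ltn_ord j).
pose l := Ordinal jl.
have jE : j = l.+1 :> nat by rewrite /=; lia.
have [il|il] := eqVneq i l; first by rewrite il; exact: straightens_adj.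
have lt_ij : i != j by rewrite -val_eqE /=; lia.
rewrite -(transp_conj il lt_ij).
by do 2?apply: straightensM; try exact: straightens_adj; apply: IHd; rewrite /=; lia.
Qed.

Lemma straightens_all g : straightens g.
Proof.
suff S (M : 'M[C]_n) : in_gengroup (G0_gen xi) M ->
    forall g : G0, (g : 'M[C]_n) = M -> straightens g by exact: S (gengroupP g) g erefl.
elim=> {g M} [M [i j _|i]||M M' IM SM IM' SM'|M IM SM] g gE.
- by have -> : g = transp_ xi i j by [exact: val_inj]; exact: straightens_transp.
- by have -> : g = theta_ xi i by [exact: val_inj]; exact: straightens_theta.
- by have -> : g = 1%g by [exact: val_inj]; exact: straightens1.
- have -> : g = (mk_gengroup IM * mk_gengroup IM')%g by exact: val_inj.
  by apply: straightensM; [exact: SM|exact: SM'].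
have -> : g = (mk_gengroup IM)^-1%g by exact: val_inj.
by apply: straightensV; exact: SM.
Qed.

Definition e_mon (m : 'X_{1..n}) : B := \prod_(i < n) e i ^+ m i.

Lemma e_monD m i : e_mon (m + U_(i))%MM = e i * e_mon m.
Proof.
have eC (s : seq 'I_n) : e i * (\prod_(j <- s) e j ^+ m j) = (\prod_(j <- s) e j ^+ m j) * e i.
  by apply: commr_prod => j _; apply: commrX; apply: ee.
have step (s : seq 'I_n) : uniq s -> \prod_(j <- s) e j ^+ ((m + U_(i))%MM j)
    = (if i \in s then e i else 1) * \prod_(j <- s) e j ^+ m j.
  elim: s => [|j s IHs] /=; first by rewrite !big_nil mulr1.
  move=> /andP[js us]; rewrite !big_cons IHs // inE mnmDE mnm1E.
  have [ij|ij] := eqVneq i j.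
    by rewrite -ij in js *; rewrite (negPf js) mul1r addn1 exprS mulrA.
  rewrite addn0 /=; case: ifP => _; last by rewrite !mul1r.
  rewrite !mulrA; congr (_ * _); apply: esym; apply: commrX; exact: ee.
by rewrite /e_mon step ?index_enum_uniq // mem_index_enum.
Qed.

Lemma e_mon0 : e_mon 0%MM = 1.
Proof. by rewrite /e_mon big1 // => i _; rewrite mnm0E. Qed.

Definition pbw_comb (b : B) := exists L : seq (C * ('X_{1..n} * G0)),
  b = \sum_(q <- L) iota q.1 * (e_mon q.2.1 * t q.2.2).

Lemma pbw_combD b b' : pbw_comb b -> pbw_comb b' -> pbw_comb (b + b').
Proof. by move=> [L ->] [L' ->]; exists (L ++ L'); rewrite big_cat. Qed.

Lemma pbw_comb0 : pbw_comb 0.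
Proof. by exists [::]; rewrite big_nil. Qed.

Lemma pbw_comb_sum (I : Type) (s : seq I) (P : pred I) (F : I -> B) :
  (forall x, P x -> pbw_comb (F x)) -> pbw_comb (\sum_(x <- s | P x) F x).
Proof.
move=> FP; elim/big_rec: _ => [|x b Px]; first exact: pbw_comb0.
by apply: pbw_combD; apply: FP.
Qed.

Lemma pbw_combZ c b : pbw_comb b -> pbw_comb (iota c * b).
Proof.
move=> [L ->]; exists [seq (c * q.1, q.2) | q <- L]; rewrite big_map mulr_sumr.
by apply: eq_bigr => q _; rewrite /= rmorphM mulrA.
Qed.

Lemma pbw_comb_e i b : pbw_comb b -> pbw_comb (e i * b).
Proof.
move=> [L ->]; exists [seq (q.1, ((q.2.1 + U_(i))%MM, q.2.2)) | q <- L].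
rewrite big_map mulr_sumr; apply: eq_bigr => q _.
by rewrite /= e_monD mulrA -iotaC -!mulrA.
Qed.

Lemma pbw_comb_mon m g : pbw_comb (e_mon m * t g).
Proof. by exists [:: (1, (m, g))]; rewrite big_seq1 rmorph1 mul1r. Qed.

(** By induction on the degree, for all g at once: moving t_g across the first
    factor e_i leaves e_(sg i) times a shorter product, and combinations of
    shorter products with other group elements. *)
Lemma pbw_comb_t_mon g m h : pbw_comb (t g * (e_mon m * t h)).
Proof.
move: {2}(mdeg m) (erefl (mdeg m)) => d; elim: d m g => [|d IHd] m g md.
  move/eqP: md; rewrite mdeg_eq0 => /eqP->; rewrite e_mon0 mul1r tM.
  by rewrite -[t _]mul1r -e_mon0; exact: pbw_comb_mon.
have [i mi] : exists i, (0 < m i)%N.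
  apply/existsP; apply: contraT; rewrite negb_exists => /forallP m0.
  by move: md; rewrite mdegE big1 // => i _; apply/eqP; rewrite -leqn0 leqNgt m0.
have mE : m = ((m - U_(i)) + U_(i))%MM.
  apply/mnmP => j; rewrite mnmDE mnmBE mnm1E; case: eqP => [<-|_]; last by rewrite subn0 addn0.
  by rewrite subnK.
have md' : mdeg (m - U_(i))%MM = d.
  by apply/eqP; rewrite -(eqn_add2r 1) -{1}(mdeg1 i) -mdegD -mE md addn1.
have [sg /(_ i) [L LE]] := straightens_all g.
rewrite mE e_monD -!mulrA mulrA -(subrK (e (sg i) * t g) (t g * e i)) LE mulrDl.
apply: pbw_combD; last by rewrite -mulrA; apply: pbw_comb_e; exact: IHd.
rewrite mulr_suml; apply: pbw_comb_sum => q _; rewrite -mulrA; apply: pbw_combZ.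
exact: IHd.
Qed.

Lemma pbw_comb_t g b : pbw_comb b -> pbw_comb (t g * b).
Proof.
move=> [L ->]; rewrite mulr_sumr; apply: pbw_comb_sum => q _.
by rewrite mulrA -iotaC -mulrA; apply: pbw_combZ; exact: pbw_comb_t_mon.
Qed.

(** Collect the terms with the same monomial and group element and drop those with
    coefficient zero, so that independence applies. *)
Lemma pbw_comb_uniq b : pbw_comb b ->
  exists (U : seq ('X_{1..n} * G0)) (c : 'X_{1..n} * G0 -> C),
    [/\ uniq U, forall q, q \in U -> c q != 0
      & b = \sum_(q <- U) iota (c q) * (e_mon q.1 * t q.2)].
Proof.
move=> [L ->]; pose c q0 : C := \sum_(q <- L | q.2 == q0) q.1.
pose U := undup [seq q.2 | q <- L].
exists [seq q <- U | c q != 0], c; split.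
- by rewrite filter_uniq // undup_uniq.
- by move=> q; rewrite mem_filter => /andP[].
rewrite big_filter [RHS]big_mkcond /=.
rewrite [RHS](eq_bigr (fun q0 => \sum_(q <- L | q.2 == q0) iota q.1 * (e_mon q0.1 * t q0.2))).
  rewrite (exchange_big_dep predT) //= big_seq [RHS]big_seq; apply: eq_bigr => q qL.
  rewrite (eq_bigl (pred1 q.2)) => [|q0]; last by rewrite /= eq_sym.
  by rewrite -big_filter filter_pred1_uniq ?undup_uniq ?mem_undup ?map_f // big_seq1.
move=> q0 _; rewrite -mulr_suml -rmorph_sum -/(c q0).
by case: eqP => //= ->; rewrite rmorph0 mul0r.
Qed.

End AbstractHecke.

Section HeckeSpanning.
Variables (R : realType) (r n : nat) (xi c0 : R[i]).
Hypothesis xi_prim : r.-primitive_root xi.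
Local Notation B := (HH_alg r n xi c0).
Local Notation iota := (pres_scalar (@HH_rel R r n xi c0)).
Local Notation e := (HH_e r xi c0).
Local Notation t := (HH_t r c0).
Implicit Types (g h : G0 n xi) (i j : 'I_n).

Lemma HH_ee i j : e i * e j = e j * e i.
Proof.
apply/eqP; rewrite -subr_eq0; apply/eqP.
have E := pres_pi_rel (HH_rel_ee r xi c0 i j).
rewrite [LHS]rmorphB [X in X - _ = _]rmorphM [X in _ - X = _]rmorphM [RHS]rmorph0 in E.
exact: E.
Qed.

Lemma HH_t1 : t (1%g : G0 n xi) = 1.
Proof. by rewrite [LHS](pres_pi_rel (HH_rel_t1 r n xi c0)) [LHS]rmorph1. Qed.

Lemma HH_tM g h : t g * t h = t (g * h)%g.
Proof.
have E := pres_pi_rel (HH_rel_tM r c0 g h).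
rewrite [LHS]rmorphM in E; exact: E.
Qed.

Lemma HH_t_theta i j : t (theta_ xi i) * e j = e j * t (theta_ xi i).
Proof.
have E := pres_pi_rel (HH_rel_theta r xi c0 i j).
rewrite [LHS]rmorphM [RHS]rmorphM in E; exact: E.
Qed.

Lemma HH_t_far (j j' i : 'I_n) : j' = j.+1 :> nat -> i != j -> i != j' ->
  t (transp_ xi j j') * e i = e i * t (transp_ xi j j').
Proof.
move=> jj' ij ij'; have E := pres_pi_rel (HH_rel_transp_far r xi c0 jj' ij ij').
rewrite [LHS]rmorphM [RHS]rmorphM in E; exact: E.
Qed.

Lemma HH_t_near (i i' : 'I_n) : i' = i.+1 :> nat ->
  t (transp_ xi i i') * e i = e i' * t (transp_ xi i i') - c_tilde_in r iota t c0 i i'.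
Proof.
move=> ii'; have E := pres_pi_rel (HH_rel_transp r xi c0 ii').
rewrite [LHS]rmorphM [RHS]rmorphB [X in _ = X - _]rmorphM in E.
apply: etrans E _; apply: (f_equal2 (fun a b : B => a - b)) => //.
rewrite /c_tilde [LHS]pres_pi_scalar /c_tilde_in; congr (_ * _).
by rewrite [LHS]linear_sum; apply: eq_bigr => m _; exact: raddfD.
Qed.

Lemma HH_pbw (p : B) : pbw_comb iota e t p.
Proof.
elim/pres_gen_ind: p => [|| c a b Ia Ib|[i|g] a Ia].
- exact: pbw_comb0.
- by rewrite -HH_t1 -[t _]mul1r -(e_mon0 e); exact: pbw_comb_mon.
- by apply: pbw_combD => //; exact: pbw_combZ.
- exact: (pbw_comb_e (@pres_scalarC _ _ _) HH_ee).
exact: (pbw_comb_t xi_prim (@pres_scalarC _ _ _) HH_ee HH_t1 HH_tM HH_t_theta HH_t_far HH_t_near).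
Qed.

End HeckeSpanning.

(** * Commuting elements in the symplectic reflection algebra *)

(** Affine substitutions of slope prime to r permute the residues modulo r; with
    slopes 1 and r - 1 this absorbs the exponents created by conjugation and by
    exchanging i and j in s_ij^[m]. *)
Lemma sum_mod_reindex (V : nmodType) (r : nat) (f : nat -> V) u v :
  (0 < r)%N -> coprime u r -> (forall m, f (m %% r)%N = f m) ->
  \sum_(m < r) f (u * m + v)%N = \sum_(m < r) f m.
Proof.
move=> r0 ur fP.
pose p (m : 'I_r) := Ordinal (ltn_pmod (u * m + v) r0).
rewrite [RHS](reindex_inj (h := p)) /=; first by apply: eq_bigr => m _; rewrite fP.
(* two residues with the same image differ by a multiple of r less than r *)
move=> m m' [/eqP]; rewrite eqn_modDr => e; apply: val_inj => /=.
wlog le : m m' e / (m <= m')%N.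
  by move=> W; case/orP: (leq_total m m') => le; [exact: W|apply/esym/W => //; rewrite eq_sym].
move: e; rewrite eq_sym eqn_mod_dvd ?leq_mul2l ?le ?orbT // -mulnBr.
rewrite Gauss_dvdr 1?coprime_sym // => /dvdn_leq.
case: posnP => [/eqP|lt0 /(_ isT)]; first by rewrite subn_eq0 => ge _; apply/eqP; rewrite eqn_leq le.
by rewrite leqNgt (leq_ltn_trans (leq_subr _ _)) // ltn_ord.
Qed.

Section AbstractCherednik.
Variables (R : realType) (r n : nat) (xi : R[i]).
Hypothesis xi_prim : r.-primitive_root xi.
Local Notation C := R[i].
Local Notation v_ i := (@basis_vec R n i).
Local Notation alpha_ i := (@dual_vec R n i).
Local Notation G := (G n xi).
Variables (A : pzRingType) (iota : {rmorphism C -> A}).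
Hypothesis iotaC : forall c a, iota c * a = a * iota c.
Variables (Hx : 'rV[C]_n -> A) (Hy : 'cV[C]_n -> A) (Hg : G -> A).
Variables (kt : nat -> C) (k0 : C).
Implicit Types (g h : G) (i j l : 'I_n) (m t : nat) (c : C).
Hypothesis HxZ : forall c x, Hx (c *: x) = iota c * Hx x.
Hypothesis HyZ : forall c y, Hy (c *: y) = iota c * Hy y.
Hypothesis Hg1 : Hg 1%g = 1.
Hypothesis HgM : forall g h, Hg (g * h)%g = Hg g * Hg h.
Hypothesis Hgx_conj : forall g x, Hg g * Hx x * Hg g^-1%g = Hx (x *m invmx g).
Hypothesis Hgy_conj : forall g y, Hg g * Hy y * Hg g^-1%g = Hy (g *m y).
Hypothesis Hxx : forall x1 x2, Hx x1 * Hx x2 = Hx x2 * Hx x1.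
Hypothesis Hyy : forall y1 y2, Hy y1 * Hy y2 = Hy y2 * Hy y1.
Hypothesis Hyx : forall y x, Hy y * Hx x - Hx x * Hy y
  = iota (pairing y x)
     - \sum_(1 <= t < r) iota (kt t) *
         (\sum_(i < n) iota (pairing y (alpha_ i) * pairing (v_ i) x)
            * Hg (xi_ xi i ^+ t)%g)
     - iota k0 *
         (\sum_(m < r) \sum_(i < n) \sum_(j < n | i != j)
            iota (pairing y (alpha_s xi i j m) * pairing (v_s xi i j m) x)
              * Hg (s_ xi i j m)).

Lemma G_mulVg g : (g^-1 * g)%g = 1%g.
Proof. by apply: val_inj; rewrite /= mulVmx // (G_unit xi_prim (gengroupP g)). Qed.

Lemma Hg_Vg g : Hg g^-1%g * Hg g = 1.
Proof. by rewrite -HgM G_mulVg Hg1. Qed.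

Lemma Hgx g x : Hg g * Hx x = Hx (x *m invmx g) * Hg g.
Proof. by rewrite -Hgx_conj -mulrA Hg_Vg mulr1. Qed.

Lemma Hgy g y : Hg g * Hy y = Hy (g *m y) * Hg g.
Proof. by rewrite -Hgy_conj -mulrA Hg_Vg mulr1. Qed.

Lemma Hgx_monomial sg a g i : monomial_by xi sg a g ->
  Hg g * Hx (alpha_ i) = iota (xi ^- a i) * (Hx (alpha_ (sg i)) * Hg g).
Proof.
move=> gE; rewrite Hgx.
have -> : alpha_ i *m invmx g = xi ^- a i *: alpha_ (sg i).
  apply: (can_inj (mulmxK (monomial_unit xi_prim gE))).
  rewrite mulmxKV ?(monomial_unit xi_prim gE) // -scalemxAl (dual_conj _ gE).
  by rewrite scalerA mulVf ?(xiX_neq0 xi_prim) // scale1r.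
by rewrite HxZ mulrA.
Qed.

Lemma Hgy_monomial sg a g i : monomial_by xi sg a g ->
  Hg g * Hy (v_ i) = iota (xi ^+ a i) * (Hy (v_ (sg i)) * Hg g).
Proof. by move=> gE; rewrite Hgy gE HyZ mulrA. Qed.

Lemma s_monomial i j m : monomial_by xi (tperm i j)
  (fun l => if l == j then m else if l == i then (r.-1 * m)%N else 0%N)
  (s_ xi i j m).
Proof. exact: (monomial_s xi_prim). Qed.

(** The analogue of the Euler operator of the i-th coordinate. *)
Definition euler_ i : A := Hy (v_ i) * Hx (alpha_ i).

(** The roots of unity by which g acts on v_i and on alpha_i are inverse. *)
Lemma Hg_euler sg a g i : monomial_by xi sg a g -> Hg g * euler_ i = euler_ (sg i) * Hg g.
Proof.
move=> gE; rewrite /euler_ mulrA (Hgy_monomial _ gE) -!mulrA (Hgx_monomial _ gE).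
rewrite [Hy _ * (iota _ * _)]mulrA -iotaC -!mulrA mulrA -rmorphM.
by rewrite mulfV ?(xiX_neq0 xi_prim) // rmorph1 mul1r.
Qed.

(** The element K_ij that measures the failure of the v_i alpha_i to commute. *)
Definition class_sum_ i j : A := iota k0 * \sum_(m < r) Hg (s_ xi i j m).

Lemma s_mod i j m : s_ xi i j (m %% r)%N = s_ xi i j m.
Proof. by apply: val_inj; apply: s_mx_eq; rewrite (prim_expr_mod xi_prim). Qed.

Lemma Hg_class_sum sg a g i j : monomial_by xi sg a g ->
  Hg g * class_sum_ i j = class_sum_ (sg i) (sg j) * Hg g.
Proof.
move=> gE; rewrite /class_sum_ mulrA -iotaC -!mulrA mulr_sumr mulr_suml; congr (_ * _).
rewrite -(@sum_mod_reindex _ r (fun m => Hg (s_ xi (sg i) (sg j) m) * Hg g) 1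
            (a i + r.-1 * a j)) ?coprime1n ?(r_gt0 xi_prim) //; last first.
  by move=> m; rewrite s_mod.
apply: eq_bigr => m _; rewrite -!HgM mul1n addnA; congr (Hg _).
by apply: val_inj; rewrite /= (s_mx_conj xi_prim).
Qed.

Lemma coprime_pred : coprime r.-1 r.
Proof. by rewrite -{2}(prednK (r_gt0 xi_prim)) coprimenS. Qed.

Lemma s_sym i j m : i != j -> s_ xi j i m = s_ xi i j (r.-1 * m).
Proof.
move=> ij; apply: val_inj; apply: mx_basis_eq => l.
rewrite /= !s_mxE -(xiV xi_prim) invrK.
have [->|//] := eqVneq l i; have [ij'|//] := eqVneq i j.
by rewrite ij' eqxx in ij.
Qed.

Lemma sum_s_flip (f : nat -> A) : (forall m, f (m %% r)%N = f m) ->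
  \sum_(m < r) f (r.-1 * m)%N = \sum_(m < r) f m.
Proof.
move=> fP; rewrite -(sum_mod_reindex 0 (r_gt0 xi_prim) coprime_pred fP).
by apply: eq_bigr => m _; rewrite addn0.
Qed.

Lemma class_sum_sym i j : i != j -> class_sum_ j i = class_sum_ i j.
Proof.
move=> ij; rewrite /class_sum_; congr (_ * _).
rewrite -(@sum_s_flip (fun m => Hg (s_ xi i j m))); last by move=> m; rewrite s_mod.
by apply: eq_bigr => m _; rewrite s_sym.
Qed.

Lemma pairing_dual i l : pairing (v_ i) (alpha_ l) = (l == i)%:R.
Proof. by rewrite /pairing dual_basis mxE eqxx mulr1n. Qed.

Lemma pairing_alpha_s i a b m :
  pairing (v_ i) (alpha_s xi a b m) = xi ^- m * (i == a)%:R - (i == b)%:R.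
Proof. by rewrite /pairing alpha_s_basis mxE eqxx mulr1n. Qed.

Lemma pairing_v_s j a b m :
  pairing (v_s xi a b m) (alpha_ j) = 2^-1 * (xi ^+ m * (j == a)%:R - (j == b)%:R).
Proof.
rewrite /pairing /v_s -scalemxAr mulmxBr -scalemxAr !dual_basis scale_scalar_mx.
by rewrite -raddfB /= scale_scalar_mx mxE eqxx mulr1n.
Qed.

(** For a != b, the product of pairings is nonzero only when {a, b} = {i, j}. *)
Lemma bracket_sum i j m : i != j ->
  \sum_(a < n) \sum_(b < n | a != b)
    iota (pairing (v_ i) (alpha_s xi a b m) * pairing (v_s xi a b m) (alpha_ j))
      * Hg (s_ xi a b m)
  = - (iota (2^-1 * xi ^- m) * Hg (s_ xi i j m)
       + iota (2^-1 * xi ^+ m) * Hg (s_ xi j i m)).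
Proof.
move=> ij; have ji : j != i by rewrite eq_sym.
under eq_bigr do under eq_bigr do rewrite pairing_alpha_s pairing_v_s.
rewrite (bigD1 i) //= (bigD1 j) //= (bigD1 j ji) /= (bigD1 i ji) /=.
rewrite !eqxx (negPf ij) (negPf ji) !big1.
- rewrite !addr0 opprD -!mulNr -!rmorphN.
  by congr (iota _ * _ + iota _ * _); rewrite /= ?mulr1 ?mulr0 ?mulr0n; ring.
- move=> a /andP[ai aj]; rewrite big1 // => b ab.
  rewrite [i == a]eq_sym [j == a]eq_sym (negPf ai) (negPf aj) !mulr0 !sub0r.
  have [<-|ib] := eqVneq i b; first by rewrite (negPf ji) oppr0 !mulr0 rmorph0 mul0r.
  by rewrite oppr0 mul0r rmorph0 mul0r.
- by move=> b /andP[jb bi]; rewrite [i == b]eq_sym (negPf bi) mulr0 subrr mul0r rmorph0 mul0r.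
by move=> b /andP[ib bj]; rewrite [j == b]eq_sym (negPf bj) mulr0 subrr !mulr0 rmorph0 mul0r.
Qed.

(** The terms with (a, b) = (i, j) and (j, i) agree after the substitution
    m |-> -m, and together they cancel the factor 1/2. *)
Lemma bracket i j : i != j ->
  Hy (v_ i) * Hx (alpha_ j) - Hx (alpha_ j) * Hy (v_ i)
  = iota k0 * \sum_(m < r) iota (xi ^- m) * Hg (s_ xi i j m).
Proof.
move=> ij; rewrite Hyx pairing_dual eq_sym (negPf ij) rmorph0 big1 => [|t _]; last first.
  rewrite big1 ?mulr0 // => l _; rewrite !pairing_dual.
  by have [->|_] := eqVneq l i; rewrite ?mul0r ?rmorph0 ?mul0r // eq_sym (negPf ij) mulr0 rmorph0 mul0r.
rewrite subrr sub0r -mulrN -sumrN; congr (_ * _).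
under eq_bigr do rewrite bracket_sum // opprK.
rewrite big_split /=.
have -> : \sum_(m < r) iota (2^-1 * xi ^+ m) * Hg (s_ xi j i m)
        = \sum_(m < r) iota (2^-1 * xi ^- m) * Hg (s_ xi i j m).
  rewrite -(@sum_s_flip (fun m => iota (2^-1 * xi ^- m) * Hg (s_ xi i j m))).
    apply: eq_bigr => m _; rewrite s_sym //; congr (iota (_ * _) * _).
    by rewrite -(xiV xi_prim) invrK.
  by move=> m; rewrite s_mod (prim_expr_mod xi_prim).
rewrite -big_split; apply: eq_bigr => m _ /=; rewrite -mulrDl -rmorphD.
by congr (iota _ * _); field; rewrite (xiX_neq0 xi_prim).
Qed.

(** As the v_i commute among themselves, and so do the alpha_i, the commutator is
    v_j [v_i, alpha_j] alpha_i - v_i [v_j, alpha_i] alpha_j.  In both terms moving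
    s_ij^[m] to the right across the linear form cancels the root of unity. *)
Lemma euler_bracket i j : i != j ->
  euler_ i * euler_ j - euler_ j * euler_ i = (euler_ j - euler_ i) * class_sum_ i j.
Proof.
have sx i' j' m : i' != j' ->
    Hg (s_ xi i' j' m) * Hx (alpha_ i')
  = iota (xi ^+ m) * (Hx (alpha_ j') * Hg (s_ xi i' j' m)).
  move=> ij; rewrite (Hgx_monomial _ (s_monomial i' j' m)) tpermL.
  by rewrite (negPf ij) eqxx -(xiV xi_prim) invrK.
have B i' j' : i' != j' -> Hy (v_ j') * (Hy (v_ i') * Hx (alpha_ j')
     - Hx (alpha_ j') * Hy (v_ i')) * Hx (alpha_ i') = euler_ j' * class_sum_ i' j'.
  move=> ij; rewrite bracket // /class_sum_ [RHS]mulrA -iotaC [Hy _ * _]mulrA -iotaC -!mulrA.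
  congr (_ * _); rewrite mulr_suml; congr (_ * _).
  rewrite mulr_sumr; apply: eq_bigr => m _; rewrite -?mulrA sx // mulrA -rmorphM.
  by rewrite mulVf ?(xiX_neq0 xi_prim) // rmorph1 mul1r.
move=> ij; have ji : j != i by rewrite eq_sym.
rewrite mulrBl -(B i j ij) -(class_sum_sym ij) -(B j i ji) /euler_.
move: (Hyy (v_ i) (v_ j)) (Hxx (alpha_ i) (alpha_ j)).
move: (Hy (v_ i)) (Hy (v_ j)) (Hx (alpha_ i)) (Hx (alpha_ j)) => yi yj xi' xj yy xx.
have e : yj * yi * xj * xi' = yi * yj * xi' * xj.
  by rewrite -[LHS]mulrA -xx -yy !mulrA.
by rewrite !mulrBr !mulrBl !mulrA e opprB [RHS]addrC addrA subrK.
Qed.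

(** The Jucys-Murphy element attached to j. *)
Definition murphy_ j : A := \sum_(i < n | (i < j)%N) class_sum_ i j.

Lemma Hg_murphy sg a g j : monomial_by xi sg a g -> (forall i, (sg i < j) = (i < j))%N ->
  Hg g * murphy_ j = (\sum_(i < n | (i < j)%N) class_sum_ i (sg j)) * Hg g.
Proof.
move=> gE sgj; rewrite /murphy_ mulr_sumr mulr_suml [RHS](reindex_inj (@perm_inj _ sg)).
by apply: eq_big => i; [rewrite sgj | rewrite (Hg_class_sum _ _ gE)].
Qed.

Lemma class_sum_swap (i j : 'I_n) (F F' : A) :
  (forall m, Hg (s_ xi i j m) * F = F' * Hg (s_ xi i j m)) ->
  class_sum_ i j * F = F' * class_sum_ i j.
Proof.
move=> FC; rewrite /class_sum_ -mulrA mulr_suml mulrA -iotaC -mulrA; congr (_ * _).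
by rewrite mulr_sumr; apply: eq_bigr => m _; exact: FC.
Qed.

(** The element D_j, written with the sums K_ij. *)
Definition opdam_ j : A := euler_ j + murphy_ j.

Lemma tperm_lt (a i j l : 'I_n) : (a < j)%N -> (i < j)%N -> (tperm a i l < j)%N = (l < j)%N.
Proof. by move=> aj ij; case: tpermP => // ->; rewrite ?aj ?ij. Qed.

(** A reflection that exchanges two lines of index less than j permutes the terms
    of the sum attached to j, and the sum attached to i < j is made of such
    reflections. *)
Lemma murphy_commute i j : (i < j)%N -> murphy_ i * murphy_ j = murphy_ j * murphy_ i.
Proof.
move=> ij; rewrite {1 4}/murphy_ mulr_suml mulr_sumr; apply: eq_bigr => a ai.
have aj := ltn_trans ai ij; apply: class_sum_swap => m.
rewrite (Hg_murphy (s_monomial a i m)) => [|l]; last exact: tperm_lt.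
by rewrite tpermD // eq_sym -val_eqE /= gtn_eqF.
Qed.

Lemma murphy_euler i j : (i < j)%N -> murphy_ i * euler_ j = euler_ j * murphy_ i.
Proof.
move=> ij; rewrite /murphy_ mulr_suml mulr_sumr; apply: eq_bigr => a ai.
have aj := ltn_trans ai ij; apply: class_sum_swap => m.
by rewrite (Hg_euler _ (s_monomial a i m)) tpermD // -val_eqE /= ltn_eqF.
Qed.

Lemma euler_murphy i j : (i < j)%N ->
  murphy_ j * euler_ i - euler_ i * murphy_ j
  = euler_ j * class_sum_ i j - euler_ i * class_sum_ i j.
Proof.
move=> ij; rewrite /murphy_ (bigD1 i) //= mulrDl mulrDr.
have -> : class_sum_ i j * euler_ i = euler_ j * class_sum_ i j.
  by apply: class_sum_swap => m; rewrite (Hg_euler _ (s_monomial i j m)) tpermL.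
set S := \sum_(_ | _) _; have -> : S * euler_ i = euler_ i * S.
  rewrite /S mulr_suml mulr_sumr; apply: eq_bigr => a /andP[aj ai].
  apply: class_sum_swap => m.
  by rewrite (Hg_euler _ (s_monomial a j m)) tpermD // -val_eqE /= gtn_eqF.
by rewrite opprD addrACA subrr addr0.
Qed.

(** The failure of z_i and z_j to commute is compensated by the single term K_ij of
    the Jucys-Murphy element attached to j. *)
Lemma opdam_commute_lt i j : (i < j)%N -> opdam_ i * opdam_ j = opdam_ j * opdam_ i.
Proof.
move=> ij; have ne : i != j by rewrite -val_eqE /= ltn_eqF.
have := euler_bracket ne; have := euler_murphy ij; rewrite mulrBl => <- /eqP.
rewrite subr_eq addrC => /eqP zz.
rewrite /opdam_ !mulrDl !mulrDr zz (murphy_euler ij) (murphy_commute ij) !addrA.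
by rewrite subrK; congr (_ + _); rewrite addrAC.
Qed.

Lemma opdam_commute i j : opdam_ i * opdam_ j = opdam_ j * opdam_ i.
Proof.
case: (ltngtP i j) => [ij|ji|/val_inj -> //]; first exact: opdam_commute_lt.
exact/esym/opdam_commute_lt.
Qed.

Lemma Hg_opdam_diag a g j : monomial_by xi 1%g a g -> Hg g * opdam_ j = opdam_ j * Hg g.
Proof.
move=> gE; rewrite /opdam_ mulrDr mulrDl (Hg_euler _ gE) perm1 (Hg_murphy gE) ?perm1 //.
by move=> i; rewrite perm1.
Qed.

Lemma Hg_opdam_far (j j' i : 'I_n) m : j' = j.+1 :> nat -> i != j -> i != j' ->
  Hg (s_ xi j j' m) * opdam_ i = opdam_ i * Hg (s_ xi j j' m).
Proof.
move=> jj' ij ij'; have gE := s_monomial j j' m.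
rewrite /opdam_ mulrDr mulrDl (Hg_euler _ gE) tpermD 1?eq_sym // (Hg_murphy gE); last first.
  move=> l; case: tpermP => // ->; move: ij ij'; rewrite -!val_eqE /= jj'; lia.
by rewrite tpermD 1?eq_sym.
Qed.

(** Conjugation by s carries D_i to z_(i+1) plus the sum of the K_(a,i+1) with
    a < i, which is D_(i+1) without its last term K_(i,i+1). *)
Lemma Hg_opdam_near (i i' : 'I_n) m : i' = i.+1 :> nat ->
  Hg (s_ xi i i' m) * opdam_ i = (opdam_ i' - class_sum_ i i') * Hg (s_ xi i i' m).
Proof.
move=> ii'; have gE := s_monomial i i' m.
rewrite /opdam_ mulrDr (Hg_euler _ gE) tpermL (Hg_murphy gE); last first.
  move=> l; case: tpermP => // ->; rewrite ii'; lia.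
rewrite tpermL -mulrDl /murphy_ [in RHS](bigD1 i) /= ?ii' //.
rewrite [class_sum_ i i' + _]addrC addrA addrK; congr ((_ + _) * _); apply: eq_bigl => l.
by rewrite -val_eqE /= ltnS [(l <= i)%N]leq_eqVlt; case: ltngtP.
Qed.

(** Both groups consist of the same matrices. *)
Definition toG (g : G0 n xi) : G := mk_gengroup (G0_sub_G (gengroupP g)).

Lemma homothetyV i z : z != 0 -> invmx (homothety i z) = homothety i z^-1 :> 'M[C]_n.
Proof.
move=> z0; have e : homothety i z *m homothety i z^-1 = 1%:M :> 'M[C]_n.
  apply: mx_basis_eq => l; rewrite -mulmxA !homothetyE mul1mx.
  case: eqP => [->|/eqP/negPf li]; last by rewrite homothetyE li.
  by rewrite -scalemxAr homothetyE eqxx scalerA mulVf // scale1r.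
have [u _] := mulmx1_unit e.
by rewrite -[RHS](mulKmx u) e mulmx1.
Qed.

Lemma theta_powE i m : (theta_ xi i ^+ m)%g = homothety i (xi ^+ m) :> 'M[C]_n.
Proof.
elim: m => [|m IHm].
  by rewrite homothety_refl expr0 subrr scale0r mul0mx subr0.
by rewrite expgS /= IHm xi_mx_homothety.
Qed.

Lemma s_mx_factor i j z : i != j -> z != 0 ->
  homothety i z *m homothety j z^-1 *m s_mx xi i j 0
  = mx_of_images (fun l => if l == j then z *: v_ i
                           else if l == i then z^-1 *: v_ j else v_ l).
Proof.
move=> ij z0; apply: mx_basis_eq => l.
rewrite mx_of_images_basis -!mulmxA s_mxE expr0 invr1 !scale1r.
case: (l =P j) => [_|/eqP/negPf lj]; first by rewrite homothetyE (negPf ij) homothetyE eqxx.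
case: (l =P i) => [_|/eqP/negPf li].
  by rewrite homothetyE eqxx -scalemxAr homothetyE eq_sym (negPf ij).
by rewrite homothetyE lj homothetyE li.
Qed.

Lemma s_factor i j m : i != j ->
  (xi_ xi i ^+ m * xi_ xi j ^- m * s_ xi i j 0)%g = s_ xi i j m.
Proof.
move=> ij; apply: val_inj; rewrite /= !xi_powE homothetyV ?(xiX_neq0 xi_prim) //.
by rewrite s_mx_factor ?(xiX_neq0 xi_prim).
Qed.

Lemma s_factorV i j m : i != j ->
  (xi_ xi j ^+ m * xi_ xi i ^- m * s_ xi i j 0)%g = s_ xi i j (r.-1 * m).
Proof.
move=> ij; rewrite -(s_sym m ij) -[RHS]s_factor 1?eq_sym //; congr (_ * _)%g.
by apply: val_inj; rewrite /= -!transp_s /transp_mx tpermC.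
Qed.

(** As s_ij^[m] = xi_i^m xi_j^-m s_ij^[0], both summands of k~_ij contribute K_ij / 2;
    for the second one the exponents run through their opposites. *)
Lemma class_sum_factor i j : i != j ->
  iota (k0 / 2) * (\sum_(m < r) (Hg (xi_ xi i ^+ m * xi_ xi j ^- m)%g
     + Hg (xi_ xi j ^+ m * xi_ xi i ^- m)%g)) * Hg (s_ xi i j 0) = class_sum_ i j.
Proof.
move=> ij; rewrite -mulrA mulr_suml.
under eq_bigr do rewrite mulrDl -!HgM s_factor // s_factorV //.
rewrite big_split /= (@sum_s_flip (fun m => Hg (s_ xi i j m))); last first.
  by move=> m; rewrite s_mod.
by rewrite mulrDr -mulrDl -rmorphD; congr (iota _ * _); field.
Qed.

Lemma s_sq i j : Hg (s_ xi i j 0) * Hg (s_ xi i j 0) = 1.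
Proof.
rewrite -HgM; have -> : (s_ xi i j 0 * s_ xi i j 0)%g = 1%g; last exact: Hg1.
apply: val_inj; rewrite /= -transp_s; apply: mx_basis_eq => a.
by rewrite -mulmxA !mx_of_images_basis tpermK mul1mx.
Qed.

Lemma toGM (g h : G0 n xi) : toG (g * h)%g = (toG g * toG h)%g. Proof. exact: val_inj. Qed.

Lemma toG_transp i j : toG (transp_ xi i j) = s_ xi i j 0.
Proof. by apply: val_inj; rewrite /= (transp_s xi). Qed.

Lemma toG_theta_pow i m : toG (theta_ xi i ^+ m)%g = (xi_ xi i ^+ m)%g.
Proof. by apply: val_inj; rewrite /= theta_powE xi_powE. Qed.

Lemma toG_theta_powV i m : toG (theta_ xi i ^- m)%g = (xi_ xi i ^- m)%g.
Proof. by apply: val_inj; rewrite /= theta_powE xi_powE. Qed.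

Lemma xi_commute i j m :
  (xi_ xi i ^- m * xi_ xi j ^+ m = xi_ xi j ^+ m * xi_ xi i ^- m)%g.
Proof.
apply: val_inj; rewrite /= !xi_powE homothetyV ?(xiX_neq0 xi_prim) //.
apply: mx_basis_eq => l; rewrite -!mulmxA !homothetyE.
have [->|li] := eqVneq l i.
  have [->|ij] := eqVneq i j; rewrite -?scalemxAr !homothetyE ?eqxx.
    by rewrite !scalerA mulrC.
  by rewrite (negPf ij).
have [lj|lj] := eqVneq l j; rewrite -?scalemxAr !homothetyE.
  by rewrite -lj (negPf li) eqxx.
by rewrite (negPf li) (negPf lj).
Qed.

(** The homomorphism of the theorem, into any ring that satisfies the relations of
    the symplectic reflection algebra. *)
Lemma hecke_map : exists psi : {rmorphism HH_alg r n xi k0 -> A},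
  [/\ forall c a, psi (c *: a) = iota c * psi a,
      forall i, psi (HH_e r xi k0 i) = opdam_ i
    & forall g : G0 n xi, psi (HH_t r k0 g) = Hg (toG g)].
Proof.
pose f (a : HH_index n xi) : A :=
  match a with inl i => opdam_ i | inr g => Hg (toG g) end.
have [|psi [psiZ psiE]] := @pres_alg_universal C (HH_index n xi) A iota f iotaC
  (@HH_rel R r n xi k0).
  move=> phi phiZ phiE.
  have phiT (g : G0 n xi) : phi (HH_free_t g) = Hg (toG g) by exact: (phiE (inr g)).
  have phiM a b : phi (a * b) = phi a * phi b by exact: rmorphM.
  have phiD a b : phi (a + b) = phi a + phi b by exact: rmorphD.
  have phiB a b : phi (a - b) = phi a - phi b by exact: rmorphB.
  have phi0 : phi 0 = 0 by exact: rmorph0.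
  have phi1 : phi 1 = 1 by exact: rmorph1.
  have phic (i j : 'I_n) : i != j ->
    phi (c_tilde r xi k0 i j) = class_sum_ i j * Hg (s_ xi i j 0).
    move=> ij; rewrite [LHS]phiZ -class_sum_factor // -mulrA s_sq mulr1; congr (_ * _).
    rewrite [LHS](big_morph phi phiD phi0); apply: eq_bigr => m _.
    rewrite [LHS]phiD !phiT !toGM !toG_theta_pow !toG_theta_powV.
    by congr (_ + Hg _); exact: xi_commute.
  pose E i : free_alg C (HH_index n xi) := HH_free_e xi i.
  have phiE' i : phi (HH_free_e xi i) = opdam_ i by exact: (phiE (inl i)).
  move=> a b; case=> {a b}.
  - move=> i j; rewrite [LHS]phiB [X in X - _ = _]phiM [X in _ - X = _]phiM [RHS]phi0.
    by rewrite (phiE' i) (phiE' j) [X in X - _ = _]opdam_commute subrr.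
  - rewrite [RHS]phi1 phiT -Hg1; congr Hg; exact: val_inj.
  - by move=> g h; rewrite [LHS]phiM !phiT toGM HgM.
  - move=> i j; rewrite [LHS]phiM [RHS]phiM (phiE' j) phiT.
    apply: Hg_opdam_diag; exact: (@monomial_homothety _ _ xi i 1).
  - move=> j j' i jj' ij ij'; rewrite [LHS]phiM [RHS]phiM (phiE' i) phiT toG_transp.
    exact: Hg_opdam_far.
  move=> i i' ii'; rewrite [LHS]phiM [RHS]phiB [X in _ = X - _]phiM.
  have ne : i != i' by rewrite -val_eqE /= ii' ltn_eqF.
  rewrite (phiE' i) (phiE' i') phiT phic // toG_transp -mulrBl.
  exact: Hg_opdam_near.
exists psi; split=> [|i|g] //; first exact: (psiE (inl i)).
exact: (psiE (inr g)).
Qed.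

Lemma G_sub_G0 (g : 'M[C]_n) : in_gengroup (G_gen xi) g -> in_gengroup (G0_gen xi) g.
Proof.
elim=> {g} [g [i|i j m ij]||g h _ Ig _ Ih|g _ Ig].
- exact: theta_mx_in.
- rewrite -[s_mx _ _ _ _](s_mx_factor ij (xiX_neq0 xi_prim m)) -transp_s.
  apply: in_gengroupM (transp_mx_in _ _ _).
  rewrite -homothetyV ?(xiX_neq0 xi_prim) // -!theta_powE.
  apply: in_gengroupM; first exact: gengroupP.
  apply: in_gengroupV; exact: gengroupP.
- exact: in_gengroup1.
- exact: in_gengroupM.
exact: in_gengroupV.
Qed.

(** * Image and kernel *)

Section HeckeMapProperties.
Variable psi : {rmorphism HH_alg r n xi k0 -> A}.
Hypothesis psiZ : forall c a, psi (c *: a) = iota c * psi a.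
Hypothesis psi_e : forall i, psi (HH_e r xi k0 i) = opdam_ i.
Hypothesis psi_t : forall g : G0 n xi, psi (HH_t r k0 g) = Hg (toG g).

Lemma hecke_image_g g : exists b, psi b = Hg g.
Proof.
exists (HH_t r k0 (mk_gengroup (G_sub_G0 (gengroupP g)))).
by rewrite psi_t; congr Hg; exact: val_inj.
Qed.

Lemma hecke_image_euler i : exists b, psi b = euler_ i.
Proof.
have imD a a' : (exists b, psi b = a) -> (exists b, psi b = a') ->
    exists b, psi b = a + a'.
  by move=> [b <-] [b' <-]; exists (b + b'); exact: rmorphD.
have imZ c a : (exists b, psi b = a) -> exists b, psi b = iota c * a.
  by move=> [b <-]; exists (c *: b); exact: psiZ.
have im_sum (I : Type) (s : seq I) (P : pred I) (F : I -> A) :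
    (forall x, exists b, psi b = F x) -> exists b, psi b = \sum_(x <- s | P x) F x.
  move=> FP; elim/big_rec: _ => [|x a _]; first by exists 0; exact: rmorph0.
  exact: imD.
have -> : euler_ i = opdam_ i + iota (-1) * murphy_ i.
  by rewrite rmorphN rmorph1 mulN1r /opdam_ addrK.
apply: imD; first by exists (HH_e r xi k0 i).
apply: (imZ); apply: (im_sum) => a; apply: (imZ); apply: (im_sum) => m.
exact: hecke_image_g.
Qed.

Variable rho : {rmorphism A -> endo (dunkl_space C n)}.
Hypothesis rho_iota : forall c, rho (iota c) = endo_scalar (dunkl_space C n) c.
Hypothesis rho_g : forall g, rho (Hg g) = grp_op g.
Hypothesis rho_euler : forall i, has_symbol 1
  (fun H => ((const_mx 1 : 'rV[C]_n) *m H *m v_ i) 0 0 *: 'X_i) (rho (euler_ i)).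

(** The representation rho turns the images of the e_i into operators of order 1
    with symbol a nonzero multiple of x_i: the Jucys-Murphy part does not raise the
    level. *)
Lemma hecke_injective p : psi p = 0 -> p = 0.
Proof.
move=> p0.
have [U [c [uU c0 pE]]] := pbw_comb_uniq (HH_pbw xi_prim p).
rewrite pE; suff -> : U = [::] by rewrite big_nil.
have sum0 (I : Type) (s : seq I) (P : pred I) (F : I -> endo (dunkl_space C n)) :
    (forall x, has_symbol 1 (fun=> 0) (F x)) ->
    has_symbol 1 (fun=> 0) (\sum_(x <- s | P x) F x).
  move=> FS; elim/big_rec: _ => [|x f _ fS].
    move=> d w wS; split=> [k H dk|H]; first by [].
    by rewrite mul0r.
  have -> : (fun _ : 'M[C]_n => 0 : mpoly n C) = (fun=> 0 + 0) by rewrite addr0.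
  exact: symbolD.
have scale0 a f : has_symbol 1 (fun=> 0) f ->
    has_symbol 1 (fun=> 0) (endo_scalar (dunkl_space C n) a * f).
  have -> : (fun _ : 'M[C]_n => 0 : mpoly n C) = (fun=> a *: 0) by rewrite scaler0.
  rewrite {1}scaler0; exact: symbolZ.
have opdam_symbol i : has_symbol 1
    (fun H => ((const_mx 1 : 'rV[C]_n) *m H *m v_ i) 0 0 *: 'X_i) (rho (opdam_ i)).
  have -> : (fun H => ((const_mx 1 : 'rV[C]_n) *m H *m v_ i) 0 0 *: 'X_i : mpoly n C)
    = (fun H => ((const_mx 1 : 'rV[C]_n) *m H *m v_ i) 0 0 *: 'X_i + 0).
    by apply/funext => H; rewrite addr0.
  rewrite /opdam_ rmorphD; apply: symbolD; first exact: rho_euler.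
  rewrite /murphy_ rmorph_sum; apply: (sum0) => a; rewrite /class_sum_ rmorphM /= rho_iota.
  apply: scale0; rewrite rmorph_sum; apply: sum0 => m; rewrite rho_g.
  exact: symbol_grp.
pose phi x := rho (psi x).
have phiM a b : phi (a * b) = phi a * phi b.
  by rewrite /phi [psi _]rmorphM rmorphM.
have phi_sum (I : Type) (s : seq I) (F : I -> HH_alg r n xi k0) :
    phi (\sum_(x <- s) F x) = \sum_(x <- s) phi (F x).
  apply: (big_morph phi) => [a b|]; last by rewrite /phi [psi _]rmorph0 rmorph0.
  by rewrite /phi [psi _]rmorphD rmorphD.
have phi_mon (m : 'X_{1..n}) : phi (e_mon (HH_e r xi k0) m) = \prod_(i < n) rho (opdam_ i) ^+ m i.
  rewrite /e_mon (big_morph phi phiM (_ : phi 1 = 1)); last first.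
    by rewrite /phi [psi _]rmorph1 rmorph1.
  apply: eq_bigr => i _; rewrite /phi [psi _]rmorphXn rmorphXn /=.
  by rewrite psi_e.
have phi_c a : phi (pres_scalar (@HH_rel R r n xi k0) a) = endo_scalar (dunkl_space C n) a.
  by rewrite /phi psiZ [psi _]rmorph1 mulr1 rho_iota.
have phi_t (g : G0 n xi) : phi (HH_t r k0 g) = grp_op g.
  by rewrite /phi psi_t rho_g.
have phip : phi p = 0 by rewrite /phi p0 rmorph0.
apply: (pbw_independent (gm := @gengroup_val R n (G0_gen xi)) _ _ opdam_symbol _ uU c0).
- exact: val_inj.
- by move=> g; exact: (G_unit xi_prim (G0_sub_G (gengroupP g))).
- move=> i g; have [sg [a gE]] := G_monomial xi_prim (G0_sub_G (gengroupP g)).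
  rewrite -mulmxA (monomialV xi_prim gE) -scalemxAr mxE mulf_neq0 //.
    exact: (xiX_neq0 xi_prim).
  by rewrite -colE !mxE oner_eq0.
apply: etrans phip; rewrite [in RHS]pE [RHS]phi_sum; apply: eq_bigr => q _.
by rewrite !phiM phi_c phi_mon phi_t.
Qed.

End HeckeMapProperties.
End AbstractCherednik.

(** * The presented algebras *)

Section CherednikRelations.
Variables (R : realType) (r n : nat) (xi : R[i]).
Variable k : multiplicity r n xi.
Local Notation C := R[i].
Local Notation A := (H_alg k).
Local Notation v_ i := (@basis_vec R n i).
Local Notation alpha_ i := (@dual_vec R n i).
Local Notation G := (G n xi).
Local Notation Hx := (H_x k).
Local Notation Hy := (H_y k).
Local Notation Hg := (H_g k).
Local Notation k0 := (mult_0 k).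
Implicit Types (g h : G) (i j l : 'I_n) (m t : nat) (a b : A).
Local Notation iota := (pres_scalar (H_rel k)).

Lemma H_xP c x1 x2 : Hx (c *: x1 + x2) = c *: Hx x1 + Hx x2.
Proof. by rewrite [LHS](pres_pi_rel (H_rel_x_linear k c x1 x2)) [LHS]linearP. Qed.

Lemma H_yP c y1 y2 : Hy (c *: y1 + y2) = c *: Hy y1 + Hy y2.
Proof. by rewrite [LHS](pres_pi_rel (H_rel_y_linear k c y1 y2)) [LHS]linearP. Qed.

Lemma H_xZ c x : Hx (c *: x) = iota c * Hx x.
Proof.
have X0 : Hx 0 = 0.
  by have := H_xP (-1) 0 0; rewrite scaler0 addr0 scaleN1r addNr.
by rewrite -[c *: x]addr0 H_xP X0 addr0 pres_scalarE.
Qed.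

Lemma H_yZ c y : Hy (c *: y) = iota c * Hy y.
Proof.
have Y0 : Hy 0 = 0.
  by have := H_yP (-1) 0 0; rewrite scaler0 addr0 scaleN1r addNr.
by rewrite -[c *: y]addr0 H_yP Y0 addr0 pres_scalarE.
Qed.

Lemma H_g1 : Hg 1%g = 1.
Proof. by rewrite [LHS](pres_pi_rel (H_rel_g1 k)) [LHS]rmorph1. Qed.

Lemma H_gM g h : Hg (g * h)%g = Hg g * Hg h.
Proof. by rewrite [LHS](pres_pi_rel (H_rel_gM k g h)) [LHS]rmorphM. Qed.

Lemma H_gx_conj g x : Hg g * Hx x * Hg g^-1%g = Hx (x *m invmx g).
Proof.
have e := pres_pi_rel (H_rel_gx k g x).
rewrite [LHS]rmorphM [X in X * _ = _]rmorphM in e; exact: e.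
Qed.

Lemma H_gy_conj g y : Hg g * Hy y * Hg g^-1%g = Hy (g *m y).
Proof.
have e := pres_pi_rel (H_rel_gy k g y).
rewrite [LHS]rmorphM [X in X * _ = _]rmorphM in e; exact: e.
Qed.

Lemma H_xx x1 x2 : Hx x1 * Hx x2 = Hx x2 * Hx x1.
Proof.
apply/eqP; rewrite -subr_eq0; apply/eqP.
have e := pres_pi_rel (H_rel_xx k x1 x2).
rewrite [LHS]rmorphB [X in X - _ = _]rmorphM [X in _ - X = _]rmorphM [RHS]rmorph0 in e; exact: e.
Qed.

Lemma H_yy y1 y2 : Hy y1 * Hy y2 = Hy y2 * Hy y1.
Proof.
apply/eqP; rewrite -subr_eq0; apply/eqP.
have e := pres_pi_rel (H_rel_yy k y1 y2).
rewrite [LHS]rmorphB [X in X - _ = _]rmorphM [X in _ - X = _]rmorphM [RHS]rmorph0 in e; exact: e.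
Qed.

Lemma H_yx y x : Hy y * Hx x - Hx x * Hy y
  = iota (pairing y x)
     - \sum_(1 <= t < r) iota (mult_t k t) *
         (\sum_(i < n) iota (pairing y (alpha_ i) * pairing (v_ i) x)
            * Hg (xi_ xi i ^+ t)%g)
     - iota k0 *
         (\sum_(m < r) \sum_(i < n) \sum_(j < n | i != j)
            iota (pairing y (alpha_s xi i j m) * pairing (v_s xi i j m) x)
              * Hg (s_ xi i j m)).
Proof.
have e := pres_pi_rel (H_rel_yx k y x).
rewrite [LHS]rmorphB [X in X - _ = _]rmorphM [X in _ - X = _]rmorphM in e.
apply: etrans e _.
rewrite [LHS]rmorphB [X in X - _ = _]rmorphB.
apply: (f_equal2 (fun a b : A => a - b)); first apply: (f_equal2 (fun a b : A => a - b)).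
- by rewrite [LHS]linearZ; congr (_ *: _); exact: rmorph1.
- rewrite [LHS]linear_sum; apply: eq_bigr => t _.
  rewrite [LHS]pres_pi_scalar; congr (_ * _); rewrite [LHS]linear_sum.
  by apply: eq_bigr => i _; exact: pres_pi_scalar.
rewrite [LHS]pres_pi_scalar; congr (_ * _); rewrite [LHS]linear_sum; apply: eq_bigr => m _.
rewrite [LHS]linear_sum; apply: eq_bigr => i _; rewrite [LHS]linear_sum.
by apply: eq_bigr => j _; exact: pres_pi_scalar.
Qed.

End CherednikRelations.

Section Comparison.
Variables (R : realType) (r n : nat) (xi : R[i]).
Hypothesis xi_prim : r.-primitive_root xi.
Variable k : multiplicity r n xi.
Local Notation C := R[i].
Local Notation v_ i := (@basis_vec R n i).
Local Notation alpha_ i := (@dual_vec R n i).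
Local Notation iota := (pres_scalar (H_rel k)).
Local Notation opdam := (opdam_ r iota (H_x k) (H_y k) (H_g k) (mult_0 k)).

Lemma D_opdam j : D_ k j = opdam j.
Proof.
rewrite /D_ /opdam_ /murphy_ /euler_; apply: (f_equal2 (fun a b : H_alg k => a + b) (erefl _)).
apply: eq_bigr => i ij; have ne : i != j by rewrite -val_eqE /= ltn_eqF.
apply: etrans (class_sum_factor xi_prim iota (mult_0 k) (H_gM k) ne).
apply: (f_equal (fun a : H_alg k => a * H_g k (s_ xi i j 0))); exact: pres_scalarE.
Qed.

Lemma H_alg_symbols : exists rho : {rmorphism H_alg k -> endo (dunkl_space C n)},
  [/\ forall c, rho (iota c) = endo_scalar (dunkl_space C n) c,
      forall g, rho (H_g k g) = grp_op g
    & forall i, has_symbol 1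
        (fun H => ((const_mx 1 : 'rV[C]_n) *m H *m v_ i) 0 0 *: 'X_i)
        (rho (euler_ (H_x k) (H_y k) i))].
Proof.
have [rho [rhoZ rho_x rho_y rho_g]] := H_alg_representation xi_prim k.
exists rho; split=> [c|g|i]; last 1 first.
- have -> : rho (euler_ (H_x k) (H_y k) i) = rho (H_y k (v_ i)) * rho (H_x k (alpha_ i)).
    exact: rmorphM.
  rewrite rho_x rho_y -(lin_delta _ i); exact: symbol_dunkl_mul.
- rewrite [LHS]rhoZ (rmorph1 rho); exact: mulr1.
exact: rho_g.
Qed.

End Comparison.

Theorem proposition1p1 (R : realType) (r n : nat) (xi : R[i])
    (r_ge1 : (1 <= r)%N) (n_ge1 : (1 <= n)%N)
    (xi_prim : r.-primitive_root xi) (k : multiplicity r n xi) :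
  exists psi : {rmorphism HH_alg r n xi (mult_0 k) -> D_alg k},
    [/\ scalable psi, bijective psi,
        forall i : 'I_n, subalg_val (psi (HH_e r xi (mult_0 k) i)) = D_ k i,
        forall i : 'I_n,
          subalg_val (psi (HH_t r (mult_0 k) (theta_ xi i))) = H_g k (xi_ xi i)
      & forall u v : 'I_n, u != v ->
          subalg_val (psi (HH_t r (mult_0 k) (transp_ xi u v)))
            = H_g k (s_ xi u v 0)].
Proof.
have [psi [psiZ psi_e psi_t]] := hecke_map xi_prim (@pres_scalarC _ _ (H_rel k))
  (H_xZ k) (H_yZ k) (H_g1 k) (H_gM k) (H_gx_conj k) (H_gy_conj k) (H_xx k) (H_yy k)
  (H_yx k).
have [rho [rho_c rho_g rho_euler]] := H_alg_symbols xi_prim k.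
have gen_euler i : in_subalg (@D_gen R r n xi k) (euler_ (H_x k) (H_y k) i).
  exact/in_subalg_gen/D_gen_yx.
have gen_g g : in_subalg (@D_gen R r n xi k) (H_g k g).
  exact/in_subalg_gen/D_gen_g.
have sum_in (I : Type) (s : seq I) (P : pred I) (F : I -> H_alg k) :
    (forall x, in_subalg (@D_gen R r n xi k) (F x)) ->
    in_subalg (@D_gen R r n xi k) (\sum_(x <- s | P x) F x).
  move=> FS; apply/subalg_predP; apply: rpred_sum => x _; exact/subalg_predP.
have in_scale c a : in_subalg (@D_gen R r n xi k) a ->
    in_subalg (@D_gen R r n xi k) (pres_scalar (H_rel k) c * a).
  by move=> Ia; rewrite -pres_scalarE; exact: in_subalgZ.
have psi_gen x : in_subalg (@D_gen R r n xi k) (psi (pres_pi _ (free_gen _ x))).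
  case: x => [i|g].
    rewrite -/(HH_free_e xi i) -/(HH_e r xi (mult_0 k) i) psi_e /opdam_.
    apply: in_subalgD; first exact: gen_euler.
    by rewrite /murphy_; apply: (sum_in) => a; rewrite /class_sum_; apply: in_scale; exact: sum_in.
  by rewrite -/(HH_free_t g) -/(HH_t r (mult_0 k) g) psi_t; exact: gen_g.
have psi_surj a : @D_gen R r n xi k a -> exists b, psi b = a.
  case=> [g|i]; first exact: (hecke_image_g xi_prim psi_t).
  exact: (hecke_image_euler xi_prim psiZ psi_e psi_t).
have [phi [phiZ phi_bij phiE]] := isomorphism_onto_subalg psiZ psi_gen psi_surj
  (fun b => hecke_injective xi_prim psiZ psi_e psi_t rho_c rho_g rho_euler (p := b)).
exists phi; split; [exact: phiZ|exact: phi_bij|move=> i|move=> i|move=> u v uv].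
- by rewrite phiE psi_e; apply/esym; exact: D_opdam.
- by rewrite phiE psi_t; congr (H_g k _); exact: val_inj.
by rewrite phiE psi_t; congr (H_g k _); exact: toG_transp.
Qed.
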